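(* Let $K$ be a field, $S=K[x_1,\ldots,x_n]$, and let $I\subset S$ be a monomial ideal with $\dim S/I=0$. Let $L(I)\subset S^\wp$ be the ideal generated by the monomials $x_{1,a_1+1}\cdots x_{n,a_n+1}$ with $x_1^{a_1}\cdots x_n^{a_n}\in\operatorname{Mon}(S\setminus I)$. Then the graded minimal free resolution of $L(I)$ is cellular and supported on a regular CW-complex.
   Context: $\operatorname{Mon}(S\setminus I)$ is the (finite) set of monomials of $S$ not belonging to $I$. For $i=1,\ldots,n$ let $b_i\ge 1$ be the smallest integer with $x_i^{b_i}\in I$ (it exists since $\dim S/I=0$). $S^\wp$ is the polynomial ring over $K$ in the variables $x_{i,j}$, $1\le i\le n$, $1\le j\le b_i$. A regular CW-complex is one in which every closed cell is homeomorphic to a closed ball via its characteristic map. The minimal free resolution of a monomial ideal $J$ in a polynomial ring $R$ is cellular and supported on a regular CW-complex $X$ if the following holds: $X$ is a finite regular CW-complex whose vertices are labelled bijectively by the minimal monomial generators of $J$, each nonempty cell $\sigma$ is labelled by the least common multiple $m_\sigma$ of the labels of its vertices, and the complex with free modules $\bigoplus_{\dim\sigma=i}R\,e_\sigma$ in homological degree $i\ge 0$ ($e_\sigma$ in multidegree $m_\sigma$) and differential $\partial(e_\sigma)=\sum_{\tau}\varepsilon(\sigma,\tau)\frac{m_\sigma}{m_\tau}e_\tau$ (sum over codimension-one faces $\tau$ of $\sigma$, with $\varepsilon(\sigma,\tau)\in\{\pm1\}$ the incidence numbers of $X$), augmented by $e_v\mapsto m_v$ on vertices $v$, is a minimal free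 resolution of $J$. *)

(* Defs.v *)
From HB Require Import structures.
From mathcomp Require Import all_boot all_order all_algebra.
From mathcomp Require Import mpoly.
From mathcomp Require Import boolp classical_sets functions reals topology normedtype.

Set Implicit Arguments.
Unset Strict Implicit.
Unset Printing Implicit Defensive.

Import Order.TTheory GRing.Theory Num.Theory.
Import numFieldNormedType.Exports.

Local Open Scope classical_set_scope.
Local Open Scope ring_scope.

Section Ideals.
Variable A : comNzRingType.
Implicit Types (G I p : set A).

Definition ideal_gen G : set A :=
  [set f | exists2 s : seq (A * A),
     (forall cg, cg \in s -> G cg.2) & f = \sum_(cg <- s) cg.1 * cg.2].

(* [idealr_closed] already contains 1 \notin p. *)
Definition prime_ideal p : Prop :=
  idealr_closed (mem p) /\ prime_idealr_closed (mem p).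

Definition prime_chain I (l : nat) (q : nat -> set A) : Prop :=
  (forall i, (i <= l)%N -> prime_ideal (q i) /\ I `<=` q i) /\
  (forall i, (i < l)%N -> q i `<` q i.+1).

(* The Krull dimension of A/I is d; primes of A/I are represented by the
   primes of A that contain I. *)
Definition krull_dim_quot I (d : nat) : Prop :=
  (exists q, prime_chain I d q) /\
  (forall l q, prime_chain I l q -> (l <= d)%N).

End Ideals.

Section MonomialIdeals.
Variables (K : fieldType) (n : nat).
Implicit Types I J : set {mpoly K[n]}.

Definition monomial_ideal I : Prop :=
  exists M : set 'X_{1..n}, I = ideal_gen [set 'X_[m] | m in M].

Definition min_mon_gens J : set 'X_{1..n} :=
  [set m | J 'X_[m] /\
           forall m' : 'X_{1..n}, (m' <= m)%MM -> J 'X_[m'] -> m' = m].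

(* Exponent vectors of the elements of Mon(S \ I). *)
Definition Mon_compl I : set 'X_{1..n} := [set a | ~ I 'X_[a]].

Definition is_min_pure_power I (i : 'I_n) (b : nat) : Prop :=
  [/\ (1 <= b)%N, I ('X_i ^+ b) &
      forall k, (1 <= k)%N -> I ('X_i ^+ k) -> (b <= k)%N].

End MonomialIdeals.

Section LI.
Variables (K : fieldType) (n : nat) (b : 'I_n -> nat).

(* The index (i, j) with j : 'I_(b i) counted from 0 stands for x_{i,j+1}. *)
Definition wp_index : finType := {i : 'I_n & 'I_(b i)}.

Definition Swp := {mpoly K[#|wp_index|]}.

Definition wp_var (i : 'I_n) (j : 'I_(b i)) : Swp :=
  'X_(enum_rank (existT (fun i => 'I_(b i)) i j : wp_index)).

(* j lists the exponents of a as elements of 'I_(b i).  Such a j exists for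
   every a in Mon(S \ I) when b i is the least power of x_i lying in the
   ideal I, since then a i < b i. *)
Definition LI_gens (I : set {mpoly K[n]}) : set Swp :=
  [set f | exists2 a : 'X_{1..n}, Mon_compl I a &
           exists2 j : forall i, 'I_(b i),
             (forall i, j i = a i :> nat) & f = \prod_(i < n) wp_var (j i)].

Definition LI (I : set {mpoly K[n]}) : set Swp := ideal_gen (LI_gens I).

End LI.

Arguments LI_gens {K n} b I.
Arguments LI {K n} b I.

Section FreeResolutions.
Variables (K : fieldType) (n : nat).
Local Notation P := {mpoly K[n]}.

Definition ebasis (B : finType) (c : B) : {ffun B -> P^o} :=
  [ffun c' => (c' == c)%:R].

(* The P-linear map on the free module with basis B sending e_c to g c. *)
Definition lin_ext (B : finType) (V : lmodType P) (g : B -> V)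
  (v : {ffun B -> P^o}) : V := \sum_c v c *: g c.

(* v is homogeneous of multidegree m in the free module whose basis element
   e_c sits in multidegree deg c: v c is a scalar times x^m / x^(deg c). *)
Definition mhomog (B : finType) (deg : B -> 'X_{1..n}) (m : 'X_{1..n})
  (v : {ffun B -> P^o}) : Prop :=
  forall c, exists a : K, v c * 'X_[deg c] = a *: 'X_[m].

(* ... -> F_1 -> F_0 -> J -> 0 with F_i free on B i, given by the images of
   the basis elements.  Minimality says that the image of each differential
   is contained in (x_1, ..., x_n) times its target. *)
Definition graded_minimal_free_resolution (J : set P) (B : nat -> finType)
    (deg : forall i, B i -> 'X_{1..n})
    (d : forall i, B i.+1 -> {ffun B i -> P^o}) (aug : B 0%N -> P^o) : Prop :=
  [/\ (forall c, exists a : K, aug c = a *: 'X_[deg 0%N c]) /\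
      (forall i c, mhomog (deg i) (deg i.+1 c) (d i c)),
      range (lin_ext aug) = J,
      [set v | lin_ext aug v = 0] = range (lin_ext (d 0%N)),
      (forall i, [set v | lin_ext (d i) v = 0] = range (lin_ext (d i.+1))) &
      forall i c c', (d i c c')@_0%MM = 0].

End FreeResolutions.

Section Balls.
Variables (R : realType) (k : nat).

Definition closed_unit_ball : set 'rV[R]_k :=
  [set x | \sum_(i < k) x 0 i ^+ 2 <= 1].
Definition open_unit_ball : set 'rV[R]_k :=
  [set x | \sum_(i < k) x 0 i ^+ 2 < 1].
Definition unit_sphere : set 'rV[R]_k :=
  [set x | \sum_(i < k) x 0 i ^+ 2 = 1].

End Balls.

Definition homeo_onto_image (T U : topologicalType) (D : set T) (f : T -> U) :=
  {within D, continuous f} /\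
  exists2 g : U -> T, {within f @` D, continuous g} & {in D, cancel f g}.

(* Finite regular CW-complexes.  Only the restriction of a characteristic map
   to the closed unit ball is meaningful.  The weak-topology axiom is omitted:
   it holds automatically because there are finitely many cells. *)
Record regular_cw (R : realType) := RegularCW {
  cw_space : topologicalType;
  cw_cell : finType;
  cw_dim : cw_cell -> nat;
  cw_char : forall c, 'rV[R]_(cw_dim c) -> cw_space;
  cw_hausdorff : hausdorff_space cw_space;
  cw_regular : forall c, homeo_onto_image (@closed_unit_ball R (cw_dim c))
                                          (@cw_char c);
  cw_partition : forall x, exists! c, (@cw_char c @` @open_unit_ball R _) x;
  cw_boundary : forall c, @cw_char c @` @unit_sphere R _ `<=`
    \bigcup_(c' in [set c' | (cw_dim c' < cw_dim c)%N])
      (@cw_char c' @` @open_unit_ball R _)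
}.

Section Cells.
Variables (R : realType) (X : regular_cw R).
Implicit Types s t r : cw_cell X.

Definition cells (i : nat) : finType := {c : cw_cell X | cw_dim c == i}.

Definition closed_cell s : set (cw_space X) :=
  @cw_char R X s @` @closed_unit_ball R _.

Definition is_face t s : bool := `[< closed_cell t `<=` closed_cell s >].

Definition is_facet t s : bool :=
  is_face t s && (cw_dim s == (cw_dim t).+1).

(* The axioms characterizing the incidence numbers [s : t] of a regular
   CW-complex up to the choice of orientations of the cells (Massey; also
   Bruns-Herzog, Section 6.2).  The last two sums have exactly two terms
   whenever they are not empty; the third clause is the last one for the
   augmented complex, in which every vertex has incidence number 1 with the
   empty cell. *)
Definition incidence_function (eps : cw_cell X -> cw_cell X -> int) : Prop :=
  [/\ forall s t, is_facet t s -> eps s t = 1 \/ eps s t = -1,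
      forall s t, ~~ is_facet t s -> eps s t = 0,
      forall s, cw_dim s = 1%N -> \sum_(t | is_facet t s) eps s t = 0 &
      forall s r, cw_dim s = (cw_dim r).+2 ->
        \sum_(t | is_facet t s && is_facet r t) eps s t * eps t r = 0].

Section Labels.
Variables (K : fieldType) (n : nat) (lab : cells 0 -> 'X_{1..n}).

Definition cell_label s : 'X_{1..n} :=
  \big[@mlcm n/0%MM]_(v : cells 0 | is_face (val v) s) lab v.

Definition cell_diff (eps : cw_cell X -> cw_cell X -> int) (i : nat)
    (s : cells i.+1) : {ffun cells i -> {mpoly K[n]}^o} :=
  \sum_(t : cells i | is_facet (val t) (val s))
    ((eps (val s) (val t))%:~R *
       'X_[cell_label (val s) - cell_label (val t)]) *: ebasis K n t.

End Labels.
End Cells.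

Definition minimal_resolution_supported_on_regular_cw (R : realType)
    (K : fieldType) (n : nat) (J : set {mpoly K[n]}) : Prop :=
  exists (X : regular_cw R) (lab : cells X 0 -> 'X_{1..n})
         (eps : cw_cell X -> cw_cell X -> int),
  [/\ set_bij setT (min_mon_gens J) lab,
      incidence_function eps &
      graded_minimal_free_resolution J
        (fun i (s : cells X i) => cell_label lab (val s))
        (@cell_diff R X K n lab eps)
        (fun v : cells X 0 => 'X_[lab v])].

(* Main.v *)
Require Import Defs.
From HB Require Import structures.
From mathcomp Require Import all_boot all_order all_algebra.
From mathcomp Require Import mpoly.
From mathcomp Require Import boolp classical_sets functions reals topology normedtype.
From mathcomp Require Import realfun zify ring lra.

(* Idea: color the variable x_{i,j} by i.  A set A of variables meeting every
   color is the product A_1 x ... x A_n of simplices, and the admissible ones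
   are those with (max A_1, ..., max A_n) the exponent of a monomial outside I.
   They form a polyhedral subcomplex of a product of simplices, whose vertices
   are the generators of L(I) and whose labels are the squarefree monomials x^A.
   Up to a shift by n, its chain complex is the quotient of the simplicial
   chains on the variables by the sets missing some color, so incidence numbers
   are simplicial signs.  In multidegree u one is left with the admissible sets
   contained in supp u; these are closed under adding the least variable of
   supp u of a given color, and coning successively over these n variables
   contracts the strand to a single vertex. *)

(** Sets missing a color are zero in the quotient complex, and this shapes both the homotopy and its
    defect. Coning over an apex [t] inverts the boundary of a cycle except at those sets from which
    deleting [t] loses a color. So one coning leaves only sets whose part of that color is exactly
    [t], and after all colors a single set with [n] elements survives. In that lowest degree every
    boundary is zero in the quotient, so the cycle condition has to be the vanishing of the
    augmentation. Closure under least variables comes from divisibility: if one exponent vector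
    outside [I] bounds a set, it still bounds the set after a lower variable of an occurring color
    is added. Regularity calls for genuine homeomorphisms with balls. Once its barycenter is moved
    to the origin, a product of simplices is the unit ball of a piecewise linear gauge, and
    rescaling each ray turns this gauge into the Euclidean norm. A point lies in the open cell named
    by its support, so the CW axioms become statements about sets of variables. *)

Set Implicit Arguments.
Unset Strict Implicit.
Unset Printing Implicit Defensive.

Import Order.TTheory GRing.Theory Num.Theory.
Import numFieldNormedType.Exports.

Local Open Scope ring_scope.

(** * Signed chains on colored sets *)

Section ColoredSets.
Variables (N n : nat) (col : 'I_N -> 'I_n) (ht : 'I_N -> nat).
Hypothesis col_ht_inj : forall s t, col s = col t -> ht s = ht t -> s = t.
Implicit Types (A B C : {set 'I_N}) (s t r : 'I_N).

(* Color-major, so that two elements of equal color in a set with n + 1 elements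
   meeting all n colors are adjacent: this makes the two endpoints of an edge
   get opposite signs. *)
Definition lex s t :=
  (col s < col t)%N || (col s == col t) && (ht s < ht t)%N.

Definition full A := [forall i, [exists t in A, col t == i]].

Lemma fullP A : reflect (forall i, exists2 t, t \in A & col t = i) (full A).
Proof.
apply: (iffP forallP) => h i; first by have /exists_inP[t tA /eqP] := h i; exists t.
by have [t tA ti] := h i; apply/exists_inP; exists t => //; apply/eqP.
Qed.

Lemma full_sub A B : A \subset B -> full A -> full B.
Proof.
move=> /fintype.subsetP AB /fullP h; apply/fullP => i.
by have [t /AB tA ti] := h i; exists t.
Qed.

Lemma full_card A : full A -> (n <= #|A|)%N.
Proof.
move=> /fullP h; rewrite -[X in (X <= _)%N]card_ord -cardsT.
apply: leq_trans (leq_imset_card col A); apply: subset_leq_card.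
by apply/fintype.subsetP => i _; have [t tA <-] := h i; apply: imset_f.
Qed.

Lemma full_col_inj A : full A -> #|A| = n -> {in A &, injective col}.
Proof.
move=> fA cA; apply/imset_injP.
rewrite eqn_leq leq_imset_card /= cA -[leqLHS]card_ord -cardsT.
apply: subset_leq_card; apply/fintype.subsetP => i _.
by have /fullP/(_ i)[t tA <-] := fA; apply: imset_f.
Qed.

Lemma fullD1 A s t :
  full A -> t \in A -> t != s -> col t = col s -> full (A :\ s).
Proof.
move=> /fullP h tA ts cts; apply/fullP => i; have [r rA ri] := h i.
have [rs|rs] := eqVneq r s; last by exists r; rewrite // !inE rs.
by exists t; rewrite ?inE ?ts // cts -rs.
Qed.

Lemma lexxx s : lex s s = false.
Proof. by rewrite /lex !ltnn andbF. Qed.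

Lemma lexNge s t : s != t -> lex s t = ~~ lex t s.
Proof.
move=> st; rewrite /lex -!val_eqE /= [col t == col s :> nat]eq_sym.
case: ltngtP => //= c; have e : col s = col t by apply: val_inj.
by case: ltngtP => // eh; rewrite (col_ht_inj e eh) eqxx in st.
Qed.

(** The position of [s] in the [lex] order of [A], whether or not [s] belongs to [A];
    [(-1) ^+ par A s] is the simplicial sign of deleting [s]. *)
Definition par A s := #|[set r in A | lex r s]|.

Lemma parU1 A s t : s \notin A -> par (s |: A) t = (lex s t + par A t)%N.
Proof.
move=> sA; rewrite /par; case: (boolP (lex s t)) => st.
  rewrite (_ : [set _ in _ | _] = s |: [set r in A | lex r t]); last first.
    by apply/setP => r; rewrite !inE; case: eqP => // ->.
  by rewrite cardsU1 !inE (negPf sA).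
rewrite add0n; apply: eq_card => r; rewrite !inE.
by case: eqP => // ->; rewrite (negPf st) !andbF.
Qed.

Lemma par_idU1 A s : par (s |: A) s = par A s.
Proof.
by apply: eq_card => r; rewrite !inE; case: eqP => // ->; rewrite lexxx !andbF.
Qed.

Section Sign.
Variable K : comNzRingType.
Implicit Types f g : {set 'I_N} -> K.

(** Exactly one of [lex s t] and [lex t s] holds, so exchanging the order of two deletions changes
    the exponent by one. *)
Lemma sgn_swap A s t : s \notin A -> t \notin A -> s != t ->
  (-1) ^+ par (s |: A) t * (-1) ^+ par A s =
  - ((-1) ^+ par (t |: A) s * (-1) ^+ par A t) :> K.
Proof.
move=> sA tA st; rewrite !parU1 // (lexNge st) !exprD.
by case: (lex t s) => /=; rewrite !(expr0, expr1); ring.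
Qed.

Lemma sgn_swap_insert A s t : s \notin A -> t \notin A -> s != t ->
  (-1) ^+ par (t |: A) s * (-1) ^+ par (s |: A) t =
  - ((-1) ^+ par A t * (-1) ^+ par A s) :> K.
Proof.
move=> sA tA st; rewrite !parU1 // (lexNge st) !exprD.
by case: (lex t s) => /=; rewrite !(expr0, expr1); ring.
Qed.

Lemma sgn_sqr A s : (-1) ^+ par A s * (-1) ^+ par A s = 1 :> K.
Proof. by rewrite -exprMn mulrNN mulr1 expr1n. Qed.

(* The coefficient at A of the simplicial boundary of the chain f. *)
Definition bd f A : K :=
  \sum_(s | s \notin A) (-1) ^+ par A s * f (s |: A).

Lemma bd_bd f A : bd (bd f) A = 0.
Proof.
rewrite /bd.
pose G s t : K := if (s \notin A) && (t \notin A) && (s != t)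
  then (-1) ^+ par A s * (-1) ^+ par (s |: A) t * f (t |: (s |: A)) else 0.
have GE s t : G s t = - G t s.
  rewrite /G [t == s]eq_sym [(t \notin A) && _]andbC; case: ifP; rewrite ?oppr0//.
  move=> /andP[/andP[sA tA] st].
  rewrite finset.setUCA [X in X * f _]mulrC [X in _ = - (X * f _)]mulrC sgn_swap //.
  by rewrite mulNr.
have G0 s : G s s = 0 by rewrite /G eqxx andbF.
transitivity (\sum_s \sum_t G s t).
  rewrite big_mkcond /=; apply: eq_bigr => s _; case: ifP => sA; last first.
    by rewrite big1 // => t _; rewrite /G sA.
  rewrite mulr_sumr big_mkcond /=; apply: eq_bigr => t _.
  rewrite /G sA !inE negb_or [s == t]eq_sym andbC.
  by case: ifP => // _; rewrite ?mulrA ?mulr0.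
(* Antisymmetry alone shows only that twice the sum vanishes, which is too weak when 2 is a zero
   divisor; hence the terms are paired explicitly across the diagonal. *)
have split1 s : \sum_t G s t =
    \sum_(t : 'I_N | (s < t)%N) G s t + \sum_(t : 'I_N | (t < s)%N) G s t.
  rewrite (bigID (fun t : 'I_N => s < t)%N) /=; congr (_ + _).
  rewrite [LHS](bigID (fun t : 'I_N => t < s)%N) /= [X in _ + X]big1 ?addr0.
    by apply: eq_bigl => t; case: ltngtP.
  move=> t; rewrite -!leqNgt andbC -eqn_leq => /eqP e.
  by rewrite (_ : t = s) ?G0 //; exact: ord_inj.
under eq_bigr do rewrite split1; rewrite big_split /=.
rewrite [X in _ + X](exchange_big_dep xpredT) //= -big_split big1 //= => s _.
by rewrite -big_split big1 //= => t _; rewrite [G t s]GE subrr.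
Qed.

(** By pigeonhole exactly one color occurs twice in [C], and only the deletion of one of its two
    elements keeps all colors. These are the two endpoints of an edge, and the color-major order
    gives them opposite signs. *)
Lemma edge_sgn C : full C -> #|C| = n.+1 ->
  \sum_(s in C | full (C :\ s)) (-1) ^+ par C s = 0 :> K.
Proof.
move=> fC cC.
have [s [t [sC tC cst lst]]] : exists s t,
   [/\ s \in C, t \in C, col s = col t & lex s t].
  have /negP ninj : ~~ dinjectiveb col (mem C).
    apply/negP => /dinjectiveP/card_in_imset; rewrite cC => h.
    by have := max_card (mem (col @: C)); rewrite h card_ord ltnn.
  have [[s [t [sC tC cst st]]]|no] :=
      pselect (exists s t, [/\ s \in C, t \in C, col s = col t & s != t]).
    case: (boolP (lex s t)) => lst; first by exists s, t.
    by exists t, s; rewrite lexNge // eq_sym.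
  exfalso; apply: ninj; apply/dinjectiveP => s t sC tC cst.
  by apply/eqP/negPn/negP => st; apply: no; exists s, t.
have st : s != t by apply/eqP => e; rewrite e lexxx in lst.
have ts : t != s by rewrite eq_sym.
have fs : full (C :\ s) by apply: (fullD1 (t := t)).
have ft : full (C :\ t) by apply: (fullD1 (t := s)).
have cs : #|C :\ s| = n by have := cardsD1 s C; rewrite sC cC => -[].
rewrite (bigD1 s) ?sC //= (bigD1 t) ?tC ?ft ?ts //= big1 ?addr0; last first.
  move=> r /andP[/andP[/andP[rC fr] rs] rt]; exfalso.
  have /fullP/(_ (col r))[q] := fr; rewrite !inE => /andP[qr qC] cq.
  have [qs|qs] := eqVneq q s.
    move: rt; rewrite (full_col_inj fs cs (x := r) (y := t)) ?inE ?rs ?ts ?rC ?eqxx //.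
    by rewrite -cq qs.
  by move: qr; rewrite (full_col_inj fs cs (x := q) (y := r)) ?inE ?rs ?qs ?rC ?eqxx //.
have -> : par C t = (par C s).+1.
  rewrite /par (_ : [set r in C | lex r t] = s |: [set r in C | lex r s]).
    by rewrite cardsU1 !inE lexxx andbF.
  apply/setP => r; rewrite !inE; have [->|rs] := eqVneq r s; first by rewrite sC lst.
  rewrite orFb; case: (boolP (r \in C)) => //= rC.
  have [->|rt] := eqVneq r t; first by rewrite lexxx lexNge // lst.
  have crt : col r != col t.
    apply: contraNneq rt => crt; apply/eqP.
    by apply: (full_col_inj fs cs); rewrite ?inE ?rs ?ts.
  by rewrite /lex cst (negPf crt).
by rewrite exprS mulN1r subrr.
Qed.

End Sign.

Section Strand.
Variables (K : comNzRingType) (Delta : {set 'I_N} -> bool).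
Hypothesis Delta_down : forall A B, A \subset B -> Delta B -> Delta A.
Hypothesis Delta_min : forall A s t, Delta A -> s \in A -> col s = col t ->
  (ht t <= ht s)%N -> Delta (t |: A).

Definition good A := full A && Delta A.

Variables (W : {set 'I_N}) (mn : 'I_n -> 'I_N).
Hypothesis mnW : forall i, mn i \in W.
Hypothesis col_mn : forall i, col (mn i) = i.
Hypothesis ht_mn : forall s, s \in W -> (ht (mn (col s)) <= ht s)%N.
Implicit Types f g : {set 'I_N} -> K.

Definition chain k f := forall A, f A != 0 -> [/\ good A, A \subset W & #|A| = k].

(** The boundary is tested only on full sets, the others being zero in the quotient. For [k = n]
    that test is vacuous, since a full set has at least [n] elements, and the augmentation takes its
    place. *)
Definition is_cycle k f := (forall B, full B -> bd f B = 0) /\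
  (k = n -> \sum_A f A = 0).

(* In the colors below r the chain only uses the apexes [mn]. *)
Definition squashed (r : nat) f := forall A, f A != 0 ->
  forall s, s \in A -> (col s < r)%N -> s = mn (col s).

Lemma bd_chain k f A : chain k f -> full A -> bd f A != 0 ->
  [/\ good A, A \subset W & #|A|.+1 = k].
Proof.
move=> cf fA; apply: contra_neqP => no; apply: big1 => s sA.
have [->|/cf [/andP[_ D] sW ck]] := eqVneq (f (s |: A)) 0; first by rewrite mulr0.
case: no; rewrite /good fA -ck cardsU1 sA; split => //=.
  by apply: Delta_down D; apply: finset.subsetUr.
by apply: fintype.subset_trans sW; apply: finset.subsetUr.
Qed.

(** After exchanging the sums, each edge [C] contributes [f C] times the sum of its two endpoint
    signs. *)
Lemma sum_bd f : chain n.+1 f -> \sum_(A | full A) bd f A = 0.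
Proof.
move=> cf; rewrite /bd (exchange_big_dep xpredT) //=.
have E s : \sum_(A : {set 'I_N} | full A && (s \notin A)) (-1) ^+ par A s * f (s |: A) =
    \sum_(C : {set 'I_N} | (s \in C) && full (C :\ s)) (-1) ^+ par C s * f C.
  rewrite [RHS](reindex_onto (fun A => s |: A) (fun C => C :\ s)) /=; last first.
    by move=> C /andP[sC _]; rewrite finset.setD1K.
  apply: eq_big => [A|A /andP[_ sA]]; last by rewrite par_idU1.
  rewrite finset.setU11 /=.
  case: (boolP (s \in A)) => sA; last by rewrite finset.setU1K // eqxx.
  rewrite andbF; apply/esym/negbTE; rewrite negb_and orbC; apply/orP; left.
  by apply/eqP => e; move: sA; rewrite -e !inE eqxx.
under eq_bigr do rewrite E; rewrite (exchange_big_dep xpredT) //=.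
apply: big1 => C _; have [->|/cf [/andP[fC _] _ cC]] := eqVneq (f C) 0.
  by apply: big1 => s _; rewrite mulr0.
by rewrite -mulr_suml edge_sgn // mul0r.
Qed.

Lemma bdD f g A : bd (fun B => f B + g B) A = bd f A + bd g A.
Proof. by rewrite /bd -big_split; apply: eq_bigr => s _; rewrite mulrDr. Qed.

Definition cone t f C : K := if t \in C then (-1) ^+ par C t * f (C :\ t) else 0.

Lemma cone_neq0 t f C : cone t f C != 0 -> t \in C /\ f (C :\ t) != 0.
Proof.
rewrite /cone; case: ifP => [tC h|_]; last by rewrite eqxx.
by split=> //; apply: contra_neq h => ->; rewrite mulr0.
Qed.

(** Being full, [C :\ mn r] already has an element of color [r], at least as high as the apex; so
    [Delta_min] admits the apex. *)
Lemma cone_chain k (r : 'I_n) f : chain k f -> chain k.+1 (cone (mn r) f).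
Proof.
move=> cf C /cone_neq0[tC /cf[/andP[fC DC] sC cC]]; set t := mn r in tC fC DC sC cC *.
have fC' : full C by apply: full_sub fC; apply: finset.subsetDl.
split; last by rewrite (cardsD1 t) tC cC.
  rewrite /good fC' -(finset.setD1K tC).
  have /fullP/(_ r)[s sC' cs] := fC.
  apply: (Delta_min DC sC'); first by rewrite cs col_mn.
  by have := ht_mn (fintype.subsetP sC _ sC'); rewrite cs.
by rewrite -(finset.setD1K tC) finset.subUset finset.sub1set mnW.
Qed.

Lemma bd_cone_notin t f A : t \notin A -> bd (cone t f) A = f A.
Proof.
move=> tA; rewrite /bd (bigD1 t) //= big1 ?addr0 => [|s /andP[sA st]].
  by rewrite /cone finset.setU11 par_idU1 finset.setU1K // mulrA sgn_sqr mul1r.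
by rewrite /cone !inE eq_sym (negPf st) (negPf tA) mulr0.
Qed.

(** This is the homotopy formula [bd (cone f) = f - cone (bd f)]: the last term at [A] is a sign
    times [bd f (A :\ t)]. For a cycle it vanishes as long as [A :\ t] is full. *)
Lemma bd_cone_in t f A : t \in A -> bd f (A :\ t) = 0 -> bd (cone t f) A = f A.
Proof.
move=> tA; have tB : t \notin A :\ t by rewrite !inE eqxx.
move: (A :\ t) tB (finset.setD1K tA) => B tB <-.
rewrite {1}/bd (bigD1 t) //= => /(canRL (addKr _)); rewrite addr0 => E.
transitivity (- (-1) ^+ par B t *
    \sum_(s | (s \notin B) && (s != t)) (-1) ^+ par B s * f (s |: B)).
  rewrite /bd mulr_sumr; apply: eq_big => [s|s]; first by rewrite !inE negb_or andbC.
  rewrite !inE negb_or => /andP[st sB].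
  rewrite /cone finset.setUCA finset.setU11 par_idU1 finset.setU1K; last first.
    by rewrite finset.in_setU1 negb_or eq_sym st.
  by rewrite [LHS]mulrA sgn_swap_insert // mulNr [RHS]mulrA mulNr mulNr.
by rewrite E !mulrN mulNr opprK mulrA sgn_sqr mul1r.
Qed.

(* f - bd (cone f) vanishes on A unless the color r part of A is the apex. *)
Lemma squash k (r : 'I_n) f : chain k f -> is_cycle k f -> squashed r f ->
  exists g, chain k.+1 g /\
    let f' A := if full A then f A - bd g A else 0 in
    [/\ chain k f', is_cycle k f' & squashed r.+1 f'].
Proof.
move=> cf [zf zn] sf; set t := mn r; exists (cone t f).
have cg := cone_chain (r := r) cf; split=> // f'.
have f'P A : f' A != 0 -> [/\ full A, t \in A & ~~ full (A :\ t)].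
  rewrite /f'; case: ifP => fA; last by rewrite eqxx.
  case: (boolP (t \in A)) => tA; last by rewrite bd_cone_notin // subrr eqxx.
  case: (boolP (full (A :\ t))) => // fAt.
  by rewrite bd_cone_in ?zf // subrr eqxx.
have f'Q A : f' A != 0 -> f A != 0 \/ bd (cone t f) A != 0.
  move=> h; have [fA _ _] := f'P _ h; move: h; rewrite /f' fA.
  have [->|] := eqVneq (f A) 0; last by left.
  by rewrite sub0r oppr_eq0; right.
split.
- move=> A h; case: (f'Q _ h) => [/cf //|].
  have [fA _ _] := f'P _ h.
  by move=> /(bd_chain cg fA)[gA AW [kA]].
(* Cutting [f'] off at non-full sets does not affect its boundary at a full [B], because supersets
   of full sets are full. *)
- split=> [B fB|kn].
    transitivity (bd f B - bd (bd (cone t f)) B); last by rewrite zf // bd_bd subrr.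
    rewrite /f'; move: (bd (cone t f)) => h; rewrite /bd -sumrB.
    apply: eq_bigr => s _; rewrite (full_sub _ fB) ?mulrBr //.
    exact: finset.subsetUr.
  rewrite kn in cg; rewrite /f' -big_mkcond /= sumrB (sum_bd cg) subr0.
  rewrite big_mkcond /= -[RHS](zn kn); apply: eq_bigr => A _; case: ifP => // /negP fA.
  by have [->//|/cf[/andP[]]] := eqVneq (f A) 0.
move=> A h s sA; rewrite ltnS leq_eqVlt => /orP[/eqP csr|csr].
  have cr : col s = r by apply: ord_inj.
  rewrite cr; apply/eqP/negPn/negP => st; have [fA tA] := f'P _ h.
  by move/negP; apply; apply: (fullD1 (t := s)) => //; rewrite cr col_mn.
case: (f'Q _ h) => [/sf|bA]; first exact.
(* A nonzero boundary at [A] comes from some [q |: A] with [f] nonzero after the apex is removed.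
   The element [s] survives this removal because its color is below [r], so the earlier squashing
   applies to it. *)
have [q _ /cone_neq0[_ /sf]] : exists2 q, q \notin A & cone t f (q |: A) != 0.
  have [//|no] := pselect (exists2 q, q \notin A & cone t f (q |: A) != 0).
  case/eqP: bA; apply: big1 => q qA; have [->|h'] := eqVneq (cone t f (q |: A)) 0.
    by rewrite mulr0.
  by case: no; exists q.
apply=> //; rewrite !inE sA orbT andbT; apply: contraTneq csr => ->.
by rewrite col_mn ltnn.
Qed.

Lemma strand_exact k f : chain k f -> is_cycle k f ->
  exists2 g, chain k.+1 g & forall B, full B -> bd g B = f B.
Proof.
have [m] : exists m, squashed (n - m) f by exists n; rewrite subnn.
elim: m f => [|m IH] f sf cf zf.
  suff f0 A : f A = 0.
    exists (fun=> 0) => [A|B _]; first by rewrite eqxx.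
    by rewrite f0 /bd big1 // => s _; rewrite mulr0.
  (* With all colors squashed only the set of apexes remains, a single vertex; its coefficient
     equals the augmentation, hence vanishes. *)
  have hA B : f B != 0 -> B = mn @: [set: 'I_n] /\ k = n.
    move=> fB; have [/andP[FB _] _ <-] := cf _ fB; have {}sf := sf _ fB.
    have -> : B = mn @: [set: 'I_n].
      apply/eqP; rewrite finset.eqEcard; apply/andP; split.
        apply/fintype.subsetP => s sB; apply/imsetP; exists (col s) => //.
        by apply: sf => //; rewrite subn0 ltn_ord.
      apply: leq_trans (full_card FB).
      by rewrite -[leqRHS]card_ord -cardsT leq_imset_card.
    split=> //; rewrite card_imset ?cardsT ?card_ord //.
    exact: can_inj col_mn.
  apply/eqP/negPn/negP => fA; have [AE kn] := hA _ fA.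
  case/eqP: fA; case: zf => _ /(_ kn) <-; rewrite (bigD1 A) //= big1 ?addr0 // => B BA.
  by apply/eqP; apply: contraNT BA => /hA[-> _]; rewrite AE.
(* Subtraction is truncated: for [m >= n] the threshold is 0 both before and after the step, and no
   color has to be treated. *)
have [mn'|nm] := ltnP m n; last first.
  have e : (n - m.+1 = n - m)%N by lia.
  by rewrite e in sf; apply: IH.
have rn : (n - m.+1 < n)%N by lia.
have [g1 [cg1 /= [cf' zf' sf']]] := squash (r := Ordinal rn) cf zf sf.
have [|g2 cg2 bg2] := IH _ _ cf' zf'.
  have e : ((n - m.+1).+1 = n - m)%N by lia.
  by rewrite /= e in sf'.
exists (fun A => g1 A + g2 A) => [A|B fB]; last first.
  by rewrite bdD bg2 // fB addrC subrK.
have [/eqP->|] := boolP (g1 A == 0); first by rewrite add0r => /cg2.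
by move=> /cg1.
Qed.

End Strand.
End ColoredSets.

(** * Gauges and radial homeomorphisms *)

Section Topology.
Local Open Scope classical_set_scope.

Lemma continuous_mx (T U : topologicalType) m k (f : T -> 'M[U]_(m, k)) :
  (forall i j, continuous (fun x => f x i j)) -> continuous f.
Proof.
move=> cf x A [P fP PA].
suff : \forall y \near x, forall ij : 'I_m * 'I_k, P ij.1 ij.2 (f y ij.1 ij.2).
  by apply: filterS => y h; apply: PA => i j; exact: (h (i, j)).
by apply: filter_forall => -[i j]; exact: (cf i j x _ (fP i j)).
Qed.

Lemma initial_hausdorff (S : choiceType) (T : topologicalType) (f : S -> T) :
  injective f -> hausdorff_space T -> hausdorff_space (initial_topology f).
Proof.
move=> fI hT p q pq; apply/fI/hT => A B pA qB.
have [r [rA rB]] := pq (f @^-1` A) (f @^-1` B)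
  (@initial_continuous _ _ f p _ pA) (@initial_continuous _ _ f q _ qB).
by exists (f r).
Qed.

Section Sums.
Variables (R : realType) (T : topologicalType).

Lemma continuous_bigop (op : R -> R -> R) (idx : R) (I : Type) (r : seq I)
    (P : pred I) (f : I -> T -> R) :
  (forall g h : T -> R, continuous g -> continuous h ->
    continuous (fun x => op (g x) (h x))) ->
  (forall i, P i -> continuous (f i)) ->
  continuous (fun x => \big[op/idx]_(i <- r | P i) f i x).
Proof.
move=> cop cf; elim: r => [|i r IH].
  rewrite (_ : (fun _ => _) = cst idx); first exact: cst_continuous.
  by rewrite funeqE => x; rewrite big_nil.
rewrite (_ : (fun _ => _) = if P i
  then fun x => op (f i x) (\big[op/idx]_(i <- r | P i) f i x)
  else fun x => \big[op/idx]_(i <- r | P i) f i x).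
  by case: ifP => // Pi; apply: cop => //; exact: cf.
by rewrite funeqE => x; rewrite big_cons; case: ifP.
Qed.

Lemma continuous_sum (I : Type) (r : seq I) (P : pred I) (f : I -> T -> R) :
  (forall i, P i -> continuous (f i)) ->
  continuous (fun x => \sum_(i <- r | P i) f i x).
Proof.
by apply: continuous_bigop => g h cg ch x; apply: cvgD; [exact: cg|exact: ch].
Qed.

Lemma continuous_bigmax (I : Type) (r : seq I) (P : pred I) (f : I -> T -> R) :
  (forall i, P i -> continuous (f i)) ->
  continuous (fun x => \big[Num.max/0]_(i <- r | P i) f i x).
Proof.
apply: continuous_bigop => g h cg ch x.
exact: (@continuous_max R T g h x (cg x) (ch x)).
Qed.

End Sums.

Lemma continuous_mulmxr (R : realType) k l (M : 'M[R]_(k, l)) :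
  continuous (fun y : 'rV[R]_k => y *m M).
Proof.
apply: continuous_mx => i j.
rewrite (_ : (fun _ => _) = (fun x : 'rV[R]_k => \sum_s x i s * M s j)); last first.
  by rewrite funeqE => x; rewrite mxE.
apply: continuous_sum => s _ x.
have cs : {for x, continuous (fun y : 'rV[R]_k => y i s)} by exact: coord_continuous.
exact: (continuousM cs (@cst_continuous _ _ _ x)).
Qed.

Section Gauge.
Variables (R : realType) (k : nat).
Implicit Types (p q : 'rV[R]_k -> R) (y : 'rV[R]_k).

(* The last clause makes p comparable with the norm; it is what gives continuity
   of [radial] at 0, where the quotient p y / q y is the junk value 0 / 0. *)
Definition gauge p := [/\ continuous p,
  forall a y, 0 <= a -> p (a *: y) = a * p y &
  exists2 C : R, 0 <= C & forall y, `|y| <= C * p y].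

Lemma gauge0 p : gauge p -> p 0 = 0.
Proof. by case=> _ h _; rewrite -(scale0r (0 : 'rV[R]_k)) h ?mul0r. Qed.

Lemma gauge_gt0 p y : gauge p -> y != 0 -> 0 < p y.
Proof.
case=> _ _ [C C0 h] y0; rewrite ltNge; apply: contra y0 => py.
by rewrite -normr_le0; apply: le_trans (h y) _; rewrite mulr_ge0_le0.
Qed.

Lemma gauge_ge0 p y : gauge p -> 0 <= p y.
Proof.
move=> gp; have [->|/(gauge_gt0 gp)/ltW//] := eqVneq y 0; by rewrite gauge0.
Qed.

(** Moves points along rays from the origin so that level sets of [p] become level sets of [q]; the
    unit ball of [p] thus goes to that of [q]. *)
Definition radial p q y := (p y / q y) *: y.

Lemma radial_gauge p q y : gauge p -> gauge q -> q (radial p q y) = p y.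
Proof.
move=> gp gq; rewrite /radial; have [->|y0] := eqVneq y 0.
  by rewrite scaler0 !gauge0.
have [_ hq _] := gq; rewrite hq ?divr_ge0 ?gauge_ge0 //.
by rewrite divfK // gt_eqF // gauge_gt0.
Qed.

Lemma radialK p q : gauge p -> gauge q -> cancel (radial p q) (radial q p).
Proof.
move=> gp gq y; rewrite {1}/radial radial_gauge // /radial.
have [->|y0] := eqVneq y 0; first by rewrite !scaler0.
have [_ hp _] := gp; rewrite hp ?divr_ge0 ?gauge_ge0 //.
have py := gauge_gt0 gp y0; have qy := gauge_gt0 gq y0.
rewrite scalerA (_ : _ * _ = 1) ?scale1r //.
by field; rewrite !gt_eqF.
Qed.

Lemma radial_continuous p q : gauge p -> gauge q -> continuous (radial p q).
Proof.
move=> gp gq y; have [cp _ _] := gp; have [cq _ [C C0 hq]] := gq.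
have [->|y0] := eqVneq y 0; last first.
  have qy0 : q y != 0 by rewrite gt_eqF ?gauge_gt0.
  have cid : {for y, continuous (fun z : 'rV[R]_k => z)} by [].
  exact: (continuousZ (continuousM (cp y) (continuousV qy0 (cq y))) cid).
rewrite /prop_for /continuous_at {2}/radial scaler0.
apply/(@cvgr0Pnorm_lt _ _ _ (nbhs (0 : 'rV[R]_k))) => e e0.
(* The constant [C] may be 0, so [e] is divided by [C + 1]. *)
have C1 : 0 < C + 1 by lra.
have /(@cvgr0Pnorm_lt _ _ _ (nbhs (0 : 'rV[R]_k))) h : p z @[z --> (0 : 'rV[R]_k)] --> 0.
  by rewrite -[X in _ --> X](gauge0 gp); exact: cp.
have := h (e / (C + 1)) (divr_gt0 e0 C1).
apply: filterS => z /=; rewrite /radial.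
have [->|z0] := eqVneq z 0; first by rewrite scaler0 normr0.
rewrite ger0_norm ?gauge_ge0 // ltr_pdivlMr // => pz.
have qz := gauge_gt0 gq z0.
rewrite normrZ ger0_norm ?divr_ge0 ?gauge_ge0 //; apply: le_lt_trans pz.
rewrite -mulrA ler_wpM2l ?gauge_ge0 // mulrC ler_pdivrMr //.
apply: le_trans (hq z) _; rewrite ler_pM2r //; lra.
Qed.

Definition euclid y := Num.sqrt (\sum_i y 0 i ^+ 2).

Lemma euclid_ge0 y : 0 <= \sum_i y 0 i ^+ 2.
Proof. by apply: sumr_ge0 => i _; rewrite sqr_ge0. Qed.

Lemma euclid_gauge : gauge euclid.
Proof.
split.
- move=> y; apply: continuous_comp; last exact: sqrt_continuous.
  apply: continuous_sum => i _ z.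
  have ci : {for z, continuous (fun y : 'rV[R]_k => y 0 i)} by exact: coord_continuous.
  exact: (continuousM ci ci).
- move=> a y a0; rewrite /euclid.
  under eq_bigr do rewrite mxE exprMn.
  by rewrite -mulr_sumr sqrtrM ?sqr_ge0 // sqrtr_sqr ger0_norm.
(* The norm on row vectors is the maximum norm, which the Euclidean norm dominates. *)
exists 1 => // y; rewrite mul1r [leLHS]/Num.Def.normr /= mx_normrE.
apply: bigmax_le => [|[i j] _ /=]; first exact: sqrtr_ge0.
rewrite ord1 -sqrtr_sqr ler_wsqrtr // (bigD1 j) //= lerDl.
by apply: sumr_ge0 => ? _; rewrite sqr_ge0.
Qed.

Lemma closed_unit_ballE : @closed_unit_ball R k = [set y | euclid y <= 1].
Proof.
rewrite /closed_unit_ball; apply/seteqP; split=> y /= h.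
  by rewrite -sqrtr1 ler_wsqrtr.
by rewrite -(ler_sqrt _ ler01) sqrtr1.
Qed.

Lemma open_unit_ballE : @open_unit_ball R k = [set y | euclid y < 1].
Proof.
rewrite /open_unit_ball; apply/seteqP; split=> y /= h.
  by rewrite /euclid -sqrtr1 ltr_sqrt.
by rewrite -(ltr_sqrt _ ltr01) sqrtr1.
Qed.

Lemma unit_sphereE : @unit_sphere R k = [set y | euclid y = 1].
Proof.
apply/seteqP; split=> y; rewrite /unit_sphere /euclid /=.
  by move=> ->; rewrite sqrtr1.
by move=> h; rewrite -[LHS](sqr_sqrtr (euclid_ge0 y)) h expr1n.
Qed.

End Gauge.
End Topology.

(** * The closed cells *)

Section CellGeometry.
Variables (R : realType) (N n : nat) (col : 'I_N -> 'I_n).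
Implicit Types (A B : {set 'I_N}) (s t : 'I_N) (x v : 'rV[R]_N).

(* One element of each color is left out, so that #|nonrep A| = #|A| - n is the
   dimension of the product of simplices and its elements index coordinates. *)
Definition nonrep A : {set 'I_N} :=
  [set t in A | [pick s in A | col s == col t] != Some t].

Definition supp x : {set 'I_N} := [set t | x 0 t != 0].

Lemma sum_delta (P : pred 'I_N) a : \sum_(t | P t) (t == a)%:R = (P a)%:R :> R.
Proof.
case: (boolP (P a)) => Pa; last first.
  by rewrite big1 // => t Pt; case: eqP => // e; rewrite -e Pt in Pa.
by rewrite (bigD1 a) //= eqxx big1 ?addr0 // => t /andP[_ /negPf ->].
Qed.

Variable A : {set 'I_N}.
Hypothesis fA : full col A.

Lemma rep_subproof i : exists t, [pick s in A | col s == i] = Some t.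
Proof.
case: pickP => [t _|no]; first by exists t.
by have [t tA /eqP ti] := (fullP _ _ fA) i; have := no t; rewrite tA ti.
Qed.

Definition rep i := sval (cid (rep_subproof i)).

Lemma repP i : [pick s in A | col s == i] = Some (rep i).
Proof. exact: svalP (cid (rep_subproof i)). Qed.

Lemma rep_in i : rep i \in A.
Proof. by have := repP i; case: pickP => // t /andP[tA _] [<-]. Qed.

Lemma col_rep i : col (rep i) = i.
Proof. by have := repP i; case: pickP => // t /andP[_ /eqP ti] [<-]. Qed.

Lemma mem_nonrep t : (t \in nonrep A) = (t \in A) && (t != rep (col t)).
Proof. by rewrite inE repP (inj_eq Some_inj) eq_sym. Qed.

Lemma card_nonrep : (#|nonrep A| + n)%N = #|A|.
Proof.
have rI : injective rep by apply: can_inj col_rep.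
rewrite -[X in (_ + X)%N]card_ord -cardsT -(card_imset _ rI) addnC.
rewrite -(cardsID (rep @: [set: 'I_n]) A); congr (_ + _)%N; apply: eq_card => t.
  rewrite !inE; apply/imsetP/andP => [[i _ ->]|[tA /imsetP[i _ ->]]]; last by exists i.
  by rewrite rep_in imset_f.
rewrite mem_nonrep !inE andbC; congr (~~ _ && _).
by apply/eqP/imsetP => [->|[i _ ->]]; [exists (col t)|rewrite col_rep].
Qed.

Let k := #|nonrep A|.

(** The rows are the edge vectors from the representative of a color to the other elements of that
    color. They form a basis of the vectors supported on [A] with zero sum in each color; [sel]
    reads off the coordinates, since the entry at a representative is forced by the color sum. *)
Definition lin : 'M[R]_(k, N) := \matrix_(j, t)
  ((t == enum_val j)%:R - (t == rep (col (enum_val j)))%:R).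

Definition sel x : 'rV[R]_k := \row_j x 0 (enum_val j).

Lemma lin_colsum (y : 'rV[R]_k) i : \sum_(t | col t == i) (y *m lin) 0 t = 0.
Proof.
under eq_bigr do rewrite mxE.
rewrite exchange_big /= big1 // => j _; rewrite -mulr_sumr.
under eq_bigr do rewrite mxE.
by rewrite sumrB !sum_delta col_rep subrr mulr0.
Qed.

Lemma lin_out (y : 'rV[R]_k) t : t \notin A -> (y *m lin) 0 t = 0.
Proof.
move=> tA; rewrite mxE big1 // => j _; rewrite mxE.
have := enum_valP j; rewrite mem_nonrep => /andP[jA _].
case: eqP => [e|_]; first by rewrite -e (negPf tA) in jA.
by case: eqP => [e|_]; [rewrite e rep_in in tA|rewrite subrr mulr0].
Qed.

Lemma linK (y : 'rV[R]_k) : sel (y *m lin) = y.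
Proof.
apply/rowP => j; rewrite !mxE (bigD1 j) //= !mxE eqxx big1 => [|l lj]; last first.
  rewrite mxE (inj_eq enum_val_inj) eq_sym (negPf lj).
  have := enum_valP j; rewrite mem_nonrep => /andP[_].
  case: (_ =P rep (col (enum_val l))) => [->|_ _].
    by rewrite col_rep eqxx.
  by rewrite subrr mulr0.
have := enum_valP j; rewrite mem_nonrep => /andP[_ /negPf ->].
by rewrite subr0 mulr1 addr0.
Qed.

Lemma selK x : (forall t, t \notin A -> x 0 t = 0) ->
  (forall i, \sum_(t | col t == i) x 0 t = 0) -> sel x *m lin = x.
Proof.
move=> xA xc; apply/rowP => t; rewrite mxE.
under eq_bigr do rewrite !mxE.
rewrite -(@big_enum_val _ _ _ _ (mem (nonrep A))
  (fun s => x 0 s * ((t == s)%:R - (t == rep (col s))%:R))) /=.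
case: (boolP (t \in A)) => tA; last first.
  rewrite xA // big1 // => s; rewrite mem_nonrep => /andP[sA _].
  case: eqP => [e|_]; first by rewrite -e (negPf tA) in sA.
  by case: eqP => [e|_]; [rewrite e rep_in in tA|rewrite subrr mulr0].
have [tr|tr] := eqVneq t (rep (col t)).
  have := xc (col t); rewrite (bigD1 t) //= => /(canRL (addrK _)) ->.
  rewrite sub0r -sumrN big_mkcond [RHS]big_mkcond /=; apply: eq_bigr => s _.
  rewrite mem_nonrep.
  case: (boolP (s \in A)) => sA /=; last by rewrite xA // oppr0 if_same.
  have [e|cs] := eqVneq (col s) (col t).
    rewrite e -tr eqxx andTb; case: eqVneq => // st.
    by rewrite sub0r mulrN1.
  case: ifP => // _; case: eqP => [e|_]; first by rewrite e eqxx in cs.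
  case: eqP => [e|_]; first by rewrite e col_rep eqxx in cs.
  by rewrite subrr mulr0.
rewrite (bigD1 t) ?mem_nonrep ?tA //= eqxx (negPf tr) subr0 mulr1 big1 ?addr0 // => s.
move=> /andP[_ st]; rewrite eq_sym (negPf st); case: eqP => [e|_].
  by rewrite e col_rep eqxx in tr.
by rewrite subrr mulr0.
Qed.

Definition mult t : R := #|[set s in A | col s == col t]|%:R.

Lemma mult_gt0 t : 0 < mult t.
Proof.
rewrite ltr0n; apply/card_gt0P; exists (rep (col t)).
by rewrite !inE rep_in col_rep eqxx.
Qed.

Lemma mult_ge1 t : 1 <= mult t.
Proof. by have := mult_gt0 t; rewrite ltr0n ler1n. Qed.

Definition bary : 'rV[R]_N := \row_t (if t \in A then (mult t)^-1 else 0).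

Lemma bary_colsum i : \sum_(t | col t == i) bary 0 t = 1.
Proof.
under eq_bigr do rewrite mxE; rewrite -big_mkcondr /=.
rewrite (eq_bigr (fun=> (mult (rep i))^-1)) => [|t /andP[/eqP ti _]]; last first.
  by rewrite /mult col_rep ti.
rewrite sumr_const -[LHS]mulr_natl (_ : _%:R = mult (rep i)) ?divff ?gt_eqF ?mult_gt0 //.
congr (_%:R); apply: eq_card => s; by rewrite !inE col_rep unfold_in andbC.
Qed.

(* The Minkowski functional of the cell translated so that its barycenter is 0. *)
Definition cgauge (y : 'rV[R]_k) : R :=
  \big[Num.max/0]_(t in A) (- (y *m lin) 0 t * mult t).

Lemma le_cgauge y t : t \in A -> - (y *m lin) 0 t * mult t <= cgauge y.
Proof. by move=> tA; rewrite /cgauge; exact: le_bigmax_cond. Qed.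

Lemma cgauge_pos y : 0 <= cgauge y.
Proof. exact: bigmax_ge_id. Qed.

Lemma cgauge_gauge : gauge cgauge.
Proof.
split.
- apply: continuous_bigmax => t _ y.
  have c1 : {for y, continuous (fun z : 'rV[R]_k => (z *m lin) 0 t)}.
    apply: (@continuous_comp _ _ _ (fun z : 'rV[R]_k => z *m lin)
      (fun z : 'rV[R]_N => z 0 t)).
      exact: continuous_mulmxr.
    exact: coord_continuous.
  exact: (continuousM (continuousN c1) (@cst_continuous _ _ _ y)).
- move=> a y a0; rewrite /cgauge.
  rewrite (big_morph (fun z => a * z) (fun z w => maxr_pMr z w a0) (mulr0 a)).
  by apply: eq_bigr => t _; rewrite -scalemxAl mxE -mulrN mulrA.
(* Each coordinate of [y] is an entry of [y *m lin]. Entries are bounded below by [- cgauge y]; an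
   upper bound follows because an entry is minus the sum of the others of its color, fewer than [N]
   in number. *)
exists N%:R => // y; rewrite [leLHS]/Num.Def.normr /= mx_normrE.
have lb t : - (y *m lin) 0 t <= cgauge y.
  case: (boolP (t \in A)) => tA; last by rewrite lin_out // oppr0 cgauge_pos.
  have := le_cgauge y tA; rewrite -ler_pdivlMr ?mult_gt0 // => /le_trans; apply.
  by rewrite ler_pdivrMr ?mult_gt0 // ler_peMr ?cgauge_pos ?mult_ge1.
apply: bigmax_le => [|[i j] _ /=]; first by rewrite mulr_ge0 ?cgauge_pos.
rewrite ord1 -{1}(linK y) mxE; set t := enum_val j.
have N1 : 1 <= N%:R :> R by rewrite ler1n; case: (N) t => // -[].
rewrite ler_norml; apply/andP; split.
  by rewrite lerNl (le_trans (lb t)) // ler_peMl ?cgauge_pos.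
have := lin_colsum y (col t); rewrite (bigD1 t) //= => /(canRL (addrK _)) ->.
rewrite sub0r -sumrN.
apply: (@le_trans _ _ (\sum_(s | (col s == col t) && (s != t)) cgauge y)).
  by apply: ler_sum => s _.
rewrite sumr_const -[leLHS]mulr_natl ler_wpM2r ?cgauge_pos // ler_nat.
by rewrite -[leqRHS]card_ord max_card.
Qed.

Definition cell_pt (y : 'rV[R]_k) : 'rV[R]_N :=
  bary + radial (@euclid R k) cgauge y *m lin.

Definition cell_inv x : 'rV[R]_k :=
  radial cgauge (@euclid R k) (sel (x - bary)).

Lemma cell_ptK : cancel cell_pt cell_inv.
Proof.
move=> y; rewrite /cell_inv /cell_pt addrC addKr linK radialK //.
  exact: euclid_gauge.
exact: cgauge_gauge.
Qed.

Lemma cell_pt_continuous : continuous cell_pt.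
Proof.
move=> y.
have h : {for y, continuous (fun z => radial (@euclid R k) cgauge z *m lin)}.
  apply: (@continuous_comp _ _ _ (radial (@euclid R k) cgauge)
    (fun z : 'rV[R]_k => z *m lin)).
    apply: radial_continuous; [exact: euclid_gauge|exact: cgauge_gauge].
  exact: continuous_mulmxr.
exact: (continuousD (@cst_continuous _ _ bary y) h).
Qed.

Lemma cell_inv_continuous : continuous cell_inv.
Proof.
move=> x; apply: (@continuous_comp _ _ _ (fun z : 'rV[R]_N => sel (z - bary))
  (radial cgauge (@euclid R k))); last first.
  apply: radial_continuous; [exact: cgauge_gauge|exact: euclid_gauge].
apply: continuous_mx => i j z.
have c1 : {for z, continuous (fun z : 'rV[R]_N => z 0 (enum_val j))}.
  exact: coord_continuous.
rewrite (_ : (fun _ => _) = (fun z : 'rV[R]_N => z 0 (enum_val j) - bary 0 (enum_val j))).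
  exact: (continuousB c1 (@cst_continuous _ _ _ z)).
by rewrite funeqE => w; rewrite !mxE.
Qed.

Lemma cell_pt_colsum y i : \sum_(t | col t == i) cell_pt y 0 t = 1.
Proof.
rewrite /cell_pt; under eq_bigr do rewrite mxE.
by rewrite big_split /= bary_colsum lin_colsum addr0.
Qed.

Lemma cell_pt_out y t : t \notin A -> cell_pt y 0 t = 0.
Proof. by move=> tA; rewrite /cell_pt mxE lin_out // mxE (negPf tA) addr0. Qed.

Lemma supp_cell_pt y : supp (cell_pt y) \subset A.
Proof.
by apply/fintype.subsetP => t; rewrite inE; apply: contraR => /(cell_pt_out y)/eqP.
Qed.

(** Translates the facet inequality [0 <= cell_pt y 0 t] into the bound 1 on one term of [cgauge],
    taken at a vector whose gauge is [euclid y]. *)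
Lemma cell_ptE y t : t \in A -> 1 - mult t * cell_pt y 0 t =
  - (radial (@euclid R k) cgauge y *m lin) 0 t * mult t.
Proof.
move=> tA; rewrite /cell_pt mxE [bary 0 t]mxE tA mulrDr divff ?gt_eqF ?mult_gt0 //.
by ring.
Qed.

Lemma cell_pt_ge0 y t : euclid y <= 1 -> 0 <= cell_pt y 0 t.
Proof.
move=> y1; case: (boolP (t \in A)) => tA; last by rewrite cell_pt_out.
have := le_cgauge (radial (@euclid R k) cgauge y) tA.
rewrite (radial_gauge _ (@euclid_gauge R k) cgauge_gauge) -cell_ptE // => h.
by rewrite -(pmulr_rge0 _ (mult_gt0 t)); lra.
Qed.

Lemma euclid_lt1 y : (euclid y < 1) = [forall t in A, 0 < cell_pt y 0 t].
Proof.
rewrite -(radial_gauge y (@euclid_gauge R k) cgauge_gauge) /cgauge.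
apply/bigmax_ltP/forall_inP => [[_ h] t tA|h].
  by have := h t tA; rewrite -cell_ptE // -(pmulr_rgt0 _ (mult_gt0 t)) => ?; lra.
split=> // t tA; rewrite -cell_ptE //.
by have := h t tA; rewrite -(pmulr_rgt0 _ (mult_gt0 t)) => ?; lra.
Qed.

Lemma cell_pt_surj x : (forall t, 0 <= x 0 t) -> supp x \subset A ->
  (forall i, \sum_(t | col t == i) x 0 t = 1) ->
  cell_pt (cell_inv x) = x /\ euclid (cell_inv x) <= 1.
Proof.
move=> x0 xA x1.
have xout t : t \notin A -> x 0 t = 0.
  by move=> tA; apply/eqP; have := contraNN (fintype.subsetP xA t) tA; rewrite inE negbK.
have vK : sel (x - bary) *m lin = x - bary.
  apply: selK => [t tA|i]; first by rewrite !mxE xout // (negPf tA) subr0.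
  under eq_bigr do rewrite mxE [(- _ : 'rV_N) _ _]mxE.
  by rewrite sumrB x1 bary_colsum subrr.
split.
  rewrite /cell_pt /cell_inv radialK ?vK ?subrKC //; last exact: euclid_gauge.
  exact: cgauge_gauge.
rewrite /cell_inv (radial_gauge _ cgauge_gauge (@euclid_gauge R k)).
apply: bigmax_le => // t tA; rewrite vK !mxE tA.
rewrite opprB mulrBl mulVf ?gt_eqF ?mult_gt0 // lerBlDr lerDl.
by rewrite mulr_ge0 // ltW ?mult_gt0.
Qed.

End CellGeometry.

(** * The regular CW-complex *)

Section Complex.
Local Open Scope classical_set_scope.
Variables (R : realType) (N n : nat) (col : 'I_N -> 'I_n).
Variable Delta : {set 'I_N} -> bool.
Hypothesis Delta_down : forall A B : {set 'I_N}, A \subset B -> Delta B -> Delta A.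

(* The carrier is the subcomplex of the product of simplices: the cell A is the
   set of points with support A. *)
Definition in_space (x : 'rV[R]_N) : bool :=
  [&& [forall t, 0 <= x 0 t], [forall i, \sum_(t | col t == i) x 0 t == 1] &
      Delta (supp x)].

Definition space := {x : 'rV[R]_N | in_space x}.
Definition cell := {A : {set 'I_N} | good col Delta A}.
Implicit Types (c d : cell) (x : space).

Lemma space_ge0 x t : 0 <= val x 0 t.
Proof. by have /and3P[/forallP/(_ t)] := valP x. Qed.

Lemma space_colsum x i : \sum_(t | col t == i) val x 0 t = 1.
Proof. by have /and3P[_ /forallP/(_ i)/eqP] := valP x. Qed.

Lemma supp_good x : good col Delta (supp (val x)).
Proof.
apply/andP; split; last by have /and3P[] := valP x.
apply/fullP => i; have [[t ti xt]|no] := pselect (exists2 t, col t = i & val x 0 t != 0).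
  by exists t; rewrite ?inE.
have := space_colsum x i; rewrite big1 => [/eqP|t /eqP ti].
  by rewrite eq_sym oner_eq0.
by apply/eqP/negPn/negP => xt; apply: no; exists t.
Qed.

Definition supp_cell x : cell := exist (fun A => good col Delta A) _ (supp_good x).

Lemma cell_full c : full col (val c).
Proof. by have /andP[] := valP c. Qed.

Definition cell_dim c := #|nonrep col (val c)|.

Lemma cell_dimE c : (cell_dim c + n)%N = #|val c|.
Proof. exact: card_nonrep (cell_full c). Qed.

Lemma cell_pt_in_space c (y : 'rV[R]_(cell_dim c)) :
  euclid y <= 1 -> in_space (cell_pt (cell_full c) y).
Proof.
move=> y1; apply/and3P; split.
- by apply/forallP => t; apply: cell_pt_ge0.
- by apply/forallP => i; rewrite cell_pt_colsum.
have /andP[_] := valP c; apply: Delta_down; exact: supp_cell_pt.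
Qed.

Lemma euclid0_le1 k : euclid (0 : 'rV[R]_k) <= 1.
Proof. by rewrite (gauge0 (@euclid_gauge R k)) ler01. Qed.

(** Outside the unit ball [cell_pt] may leave the complex; the barycenter of the cell then serves as
    a default value. *)
Definition cell_char c (y : 'rV[R]_(cell_dim c)) : space :=
  insubd (exist in_space _ (cell_pt_in_space (euclid0_le1 (cell_dim c))) : space)
    (cell_pt (cell_full c) y).

Lemma val_cell_char c (y : 'rV[R]_(cell_dim c)) :
  euclid y <= 1 -> val (cell_char y) = cell_pt (cell_full c) y.
Proof. by move=> y1; rewrite val_insubd cell_pt_in_space. Qed.

Lemma image_closed_ball c : @cell_char c @` @closed_unit_ball R _ =
  [set x | supp (val x) \subset val c].
Proof.
rewrite closed_unit_ballE; apply/seteqP; split=> [_ [y /= y1 <-]|x /= xc].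
  by rewrite val_cell_char // supp_cell_pt.
have [e y1] := cell_pt_surj (cell_full c) (space_ge0 x) xc (space_colsum x).
by exists (cell_inv (cell_full c) (val x)) => //; apply: val_inj; rewrite val_cell_char.
Qed.

Lemma supp_cell_char c (y : 'rV[R]_(cell_dim c)) : euclid y <= 1 ->
  (euclid y < 1) = (supp (val (cell_char y)) == val c).
Proof.
move=> y1; rewrite val_cell_char // (euclid_lt1 (cell_full c)).
rewrite finset.eqEsubset supp_cell_pt /=.
apply/forall_inP/fintype.subsetP => h t /h; rewrite inE; first by move/gt_eqF ->.
by rewrite lt_def cell_pt_ge0 // andbT.
Qed.

Lemma image_open_ball c : @cell_char c @` @open_unit_ball R _ =
  [set x | supp (val x) = val c].
Proof.
rewrite open_unit_ballE; apply/seteqP; split=> [_ [y /= y1 <-]|x /= xc].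
  by apply/eqP; rewrite -supp_cell_char // ltW.
have : (@cell_char c @` @closed_unit_ball R _) x by rewrite image_closed_ball /= xc.
rewrite closed_unit_ballE => -[y /= y1 yx]; exists y => //=.
by rewrite supp_cell_char // yx xc.
Qed.

Definition space_topology := initial_topology (val : space -> 'rV[R]_N).

Lemma cell_char_homeo c :
  homeo_onto_image (@closed_unit_ball R (cell_dim c))
    (@cell_char c : 'rV[R]_(cell_dim c) -> space_topology).
Proof.
split.
  apply: continuous_comp_initial.
  apply: (@subspace_eq_continuous _ _ _ (cell_pt (cell_full c))).
    move=> y; rewrite inE closed_unit_ballE /= => y1.
    by rewrite val_cell_char.
  by apply: continuous_subspaceT; apply: cell_pt_continuous.
exists (fun x : space_topology => cell_inv (cell_full c) (val x)).
  apply: continuous_subspaceT => x.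
  apply: (@continuous_comp _ _ _ (val : space_topology -> 'rV[R]_N)).
    exact: initial_continuous.
  exact: cell_inv_continuous.
move=> y; rewrite inE closed_unit_ballE /= => y1.
by rewrite val_cell_char // cell_ptK.
Qed.

Lemma space_hausdorff : hausdorff_space space_topology.
Proof. by apply: initial_hausdorff; [exact: val_inj|exact: norm_hausdorff]. Qed.

Lemma cell_partition (x : space_topology) :
  exists! c, (@cell_char c @` @open_unit_ball R _) x.
Proof.
exists (supp_cell x); split=> [|c]; first by rewrite image_open_ball.
by rewrite image_open_ball /= => xc; apply: val_inj.
Qed.

Lemma cell_boundary c : @cell_char c @` @unit_sphere R _ `<=`
  \bigcup_(d in [set d | (cell_dim d < cell_dim c)%N])
    (@cell_char d @` @open_unit_ball R _).
Proof.
rewrite unit_sphereE => x [y /= y1 yx].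
have y1' : euclid y <= 1 by rewrite y1.
exists (supp_cell x); last by rewrite image_open_ball.
rewrite -yx /= -(ltn_add2r n) !cell_dimE /=; apply: proper_card.
rewrite finset.properEneq -supp_cell_char // y1 ltxx /=.
by rewrite val_cell_char // supp_cell_pt.
Qed.

Definition cell_complex : regular_cw R :=
  RegularCW space_hausdorff cell_char_homeo cell_partition cell_boundary.

Lemma is_faceE (d c : cw_cell cell_complex) : is_face d c = (val d \subset val c).
Proof.
apply/asboolP/idP; rewrite /closed_cell /= !image_closed_ball => h; last first.
  by move=> x /= /fintype.subset_trans; apply.
(* The center of [d] has support exactly [d], so testing the inclusion of closed cells at this point
   gives the inclusion of sets. *)
have : (@cell_char d @` @open_unit_ball R _) (cell_char (0 : 'rV_(cell_dim d))).
  exists 0 => //; rewrite open_unit_ballE /= (gauge0 (@euclid_gauge R _)).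
  exact: ltr01.
rewrite image_open_ball /= => e; rewrite -e.
by apply: (h (cell_char (0 : 'rV_(cell_dim d)))); rewrite /= e.
Qed.

Lemma is_facetE (d c : cw_cell cell_complex) :
  is_facet d c = (val d \subset val c) && (#|val c| == #|val d|.+1).
Proof.
by rewrite /is_facet is_faceE /= -!cell_dimE -addSn eqn_add2r.
Qed.

End Complex.

(** * Incidence numbers *)

Section Incidence.
Variables (N n : nat) (col : 'I_N -> 'I_n) (ht : 'I_N -> nat).
Hypothesis col_ht_inj : forall s t, col s = col t -> ht s = ht t -> s = t.
Implicit Types (A B C : {set 'I_N}).

Section Delta.
Variable K : comNzRingType.

(** The boundary coefficient of a basis chain, taken over an arbitrary ring so that the integer
    incidence numbers can be compared with their images in [K] and in the polynomial ring. *)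
Definition inc A B : K := bd col ht (fun C => (C == A)%:R) B.

Lemma inc_facet B t : t \notin B -> inc (t |: B) B = (-1) ^+ par col ht B t.
Proof.
move=> tB; rewrite /inc /bd (bigD1 t) //= eqxx mulr1 big1 ?addr0 // => s /andP[sB st].
case: eqP => [e|_]; last by rewrite mulr0.
have : s \in t |: B by rewrite -e finset.setU11.
by rewrite !inE (negPf st) (negPf sB).
Qed.

Lemma inc_neq0 A B : inc A B != 0 -> exists2 t, t \notin B & A = t |: B.
Proof.
have [//|no] := pselect (exists2 t, t \notin B & A = t |: B).
move/eqP; case; apply: big1 => t tB; case: eqP => [e|_]; last by rewrite mulr0.
by case: no; exists t.
Qed.

Lemma bd_inc (f : {set 'I_N} -> K) B : bd col ht f B = \sum_A f A * inc A B.
Proof.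
rewrite /inc /bd; under [RHS]eq_bigr do rewrite mulr_sumr.
rewrite exchange_big /=; apply: eq_bigr => s _.
rewrite (bigD1 (s |: B)) //= eqxx mulr1 big1 ?addr0 1?mulrC // => A /negPf.
by rewrite eq_sym => ->; rewrite !mulr0.
Qed.

End Delta.

Lemma intr_inc (K : comNzRingType) A B : (inc int A B)%:~R = inc K A B.
Proof.
rewrite /inc /bd rmorph_sum /=; apply: eq_bigr => s _.
by rewrite rmorphM rmorphXn rmorphN1 rmorph_nat.
Qed.

Variables (R : realType) (Delta : {set 'I_N} -> bool).
Hypothesis Delta_down : forall A B, A \subset B -> Delta B -> Delta A.

Lemma sum_cells (V : nmodType) (F : {set 'I_N} -> V) (P : pred {set 'I_N}) :
  \sum_(c : cell col Delta | P (val c)) F (val c) =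
  \sum_(A | good col Delta A && P A) F A.
Proof. by rewrite (big_sub_cond (good col Delta)). Qed.

Let X := cell_complex R col Delta_down.

Definition incidence (c d : cw_cell X) : int := inc int (val c) (val d).

Lemma facetP (d c : cw_cell X) :
  reflect (exists2 t, t \notin val d & val c = t |: val d) (is_facet d c).
Proof.
rewrite is_facetE; apply: (iffP andP) => [[dc /eqP e]|[t td ->]]; last first.
  by rewrite finset.subsetUr cardsU1 td.
have /cards1P[t tE] : #|val c :\: val d| == 1%N.
  by rewrite cardsDS // e subSnn.
exists t; first by move: (finset.set11 t); rewrite -tE finset.inE => /andP[].
by rewrite -[LHS](finset.setID (val c) (val d)) tE finset.setUC (finset.setIidPr dc).
Qed.

Lemma incidenceP : incidence_function incidence.
Proof.
split.
- move=> c d /facetP[t td e]; rewrite /incidence e inc_facet //.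
  by rewrite -signr_odd; case: odd; [right|left].
- move=> c d /facetP nf; apply/eqP/negPn/negP => /inc_neq0 h; exact: nf.
(* The endpoint condition is [sum_bd] for the indicator chain of [c]; full sets outside [Delta]
   contribute nothing, since every subset of [c] is in [Delta]. *)
- move=> c c1.
  have cC : #|val c| = n.+1 by rewrite -cell_dimE; move: c1 => /= ->.
  have ch : chain col Delta [set: 'I_N] n.+1 (fun C => (C == val c)%:R : int).
    by move=> C; case: (C =P val c) => [-> _|]; rewrite ?eqxx // (valP c) finset.subsetT.
  rewrite -[RHS](sum_bd col_ht_inj ch) big_mkcond /=.
  transitivity (\sum_(d : cell col Delta) inc int (val c) (val d)).
    apply: eq_bigr => d _; case: ifP => // /facetP nf; apply/esym/eqP/negPn/negP.
    by move=> /inc_neq0; exact: nf.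
  rewrite (sum_cells (inc int (val c)) xpredT) big_mkcond [RHS]big_mkcond.
  apply: eq_bigr => A _; rewrite andbT /good; case: (boolP (full col A)) => //= fA.
  case: (boolP (Delta A)) => // DA; apply/esym/eqP/negPn/negP => /inc_neq0[t tA e].
  case/negP: DA; apply: Delta_down (finset.subsetUr [set t] A) _; rewrite -e.
  by have /andP[] := valP c.
move=> c r _; rewrite big_mkcond /=.
transitivity (\sum_(d : cell col Delta)
    inc int (val c) (val d) * inc int (val d) (val r)).
  apply: eq_bigr => d _; case: ifP => // /negP nf; apply/esym/eqP/negPn/negP.
  rewrite mulf_eq0 negb_or => /andP[/inc_neq0 h1 /inc_neq0 h2].
  by apply: nf; apply/andP; split; apply/facetP.
(* This is [bd_bd] for the indicator chain of [c]. A set with nonzero contribution lies between [r]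
   and [c], so it is full and in [Delta], hence a cell. *)
rewrite (sum_cells (fun A => inc int (val c) A * inc int A (val r)) xpredT).
rewrite -[RHS](bd_bd col_ht_inj (fun C => (C == val c)%:R : int) (val r)).
rewrite [RHS]bd_inc [LHS]big_mkcond; apply: eq_bigr => A _; rewrite andbT.
case: (boolP (good _ _ A)) => // gA; apply/esym/eqP/negPn/negP.
rewrite mulf_eq0 negb_or => /andP[/inc_neq0[t tA e] /inc_neq0[s sr e']].
case/negP: gA; apply/andP; split.
  by rewrite e'; apply: full_sub (cell_full r); rewrite finset.subsetUr.
apply: Delta_down (finset.subsetUr [set t] A) _; rewrite -e.
by have /andP[] := valP c.
Qed.

End Incidence.

(** * Multigraded strands *)

Section Monomials.
Variables (N : nat) (K : nzRingType).
Implicit Types (p : {mpoly K[N]}) (m u : 'X_{1..N}) (A B : {set 'I_N}).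

Lemma mcoeff_mulX p m u :
  (p * 'X_[m])@_u = if (m <= u)%MM then p@_(u - m) else 0.
Proof.
case: ifP => mu; first by rewrite -[in LHS](submK mu) addmC mcoeffMX.
apply/eqP; rewrite mcoeff_eq0 (perm_mem (msuppMX p m)); apply/mapP => -[k _ e].
by rewrite e lem_addr in mu.
Qed.

Lemma mesym1_coord A t : mesym1 A t = (t \in A) :> nat.
Proof. by rewrite mnmE. Qed.

Lemma mesym1_le A B : (mesym1 A <= mesym1 B)%MM = (A \subset B).
Proof.
apply/mnm_lepP/fintype.subsetP => h t.
  by have := h t; rewrite !mesym1_coord; case: (t \in A) => //; case: (t \in B).
by have := h t; rewrite !mesym1_coord; case: (t \in A) => // ->.
Qed.

Lemma mesym1_le_supp A u : (mesym1 A <= u)%MM = (A \subset [set t | u t != 0%N]).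
Proof.
apply/mnm_lepP/fintype.subsetP => h t; have := h t.
  all: rewrite mesym1_coord inE; case: (t \in A) => //=.
  by rewrite lt0n.
by rewrite lt0n => ->.
Qed.

Lemma big_mlcm (I : finType) (P : pred I) (F : I -> 'X_{1..N}) m :
  (forall i, P i -> (F i <= m)%MM) ->
  (forall t, m t != 0%N -> exists2 i, P i & F i t = m t) ->
  \big[@mlcm N/0%MM]_(i | P i) F i = m.
Proof.
move=> Fm mF.
have E t : (\big[@mlcm N/0%MM]_(i | P i) F i) t = (\max_(i | P i) F i t)%N.
  rewrite (big_morph (fun m' : 'X_{1..N} => m' t) (id1 := 0%N) (op1 := maxn)) ?mnm0E //.
  by move=> x y; rewrite mlcmE mnmDE mnmBE maxnE.
apply/mnmP => t; rewrite E; apply/eqP; rewrite eqn_leq; apply/andP; split.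
  by apply/bigmax_leqP => i Pi; exact: (mnm_lepP (Fm i Pi)).
have [->//|/mF[i Pi <-]] := eqVneq (m t) 0%N.
exact: leq_bigmax_cond.
Qed.

End Monomials.

Section Chains.
Variables (N n : nat) (col : 'I_N -> 'I_n) (ht : 'I_N -> nat).
Hypothesis col_ht_inj : forall s t, col s = col t -> ht s = ht t -> s = t.
Variables (R : realType) (Delta : {set 'I_N} -> bool).
Hypothesis Delta_down :
  forall A B : {set 'I_N}, A \subset B -> Delta B -> Delta A.
Hypothesis Delta_min : forall (A : {set 'I_N}) s t, Delta A -> s \in A ->
  col s = col t -> (ht t <= ht s)%N -> Delta (t |: A).
Variable K : fieldType.
Implicit Types (A B C : {set 'I_N}) (u m : 'X_{1..N}).

Let X := cell_complex R col Delta_down.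
Local Notation P := {mpoly K[N]}.

Definition vset i (c : cells X i) : {set 'I_N} := val (val c : cell col Delta).

Lemma vset_inj i : injective (@vset i).
Proof. by move=> c d /val_inj/val_inj. Qed.

Lemma good_vset i (c : cells X i) : good col Delta (vset c).
Proof. exact: valP (val c : cell col Delta). Qed.

Lemma card_vset i (c : cells X i) : #|vset c| = (i + n)%N.
Proof. by rewrite -cell_dimE; congr (_ + _)%N; apply/eqP; exact: valP c. Qed.

Lemma vset_ex i A : good col Delta A -> #|A| = (i + n)%N ->
  exists c : cells X i, vset c = A.
Proof.
move=> gA cA; pose c : cw_cell X := exist (fun A => good col Delta A) A gA.
have ci : cw_dim c == i by rewrite -(eqn_add2r n) cell_dimE cA.
by exists (exist _ c ci).
Qed.

Definition vertex_label (v : cells X 0) : 'X_{1..N} := mesym1 (vset v).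

(** Take [t] in its own color and the representative in each other color. It follows that no
    variable of [c] is lost in the least common multiple of the vertex labels. *)
Lemma vertex_through (c : cw_cell X) t : t \in val c ->
  exists2 v : cells X 0, t \in vset v & vset v \subset val c.
Proof.
move=> tc; pose r i := if i == col t then t else rep (cell_full c) i.
have cr i : col (r i) = i by rewrite /r; case: eqP => [->//|_]; rewrite col_rep.
have rc i : r i \in val c by rewrite /r; case: eqP => // _; exact: rep_in.
have sub : r @: [set: 'I_n] \subset val c.
  by apply/fintype.subsetP => _ /imsetP[i _ ->].
have [||v vE] := @vset_ex 0 (r @: [set: 'I_n]).
- apply/andP; split; last by have /andP[_] := valP c; exact: Delta_down.
  by apply/fullP => i; exists (r i); rewrite ?imset_f.
- by rewrite card_imset ?cardsT ?card_ord //; exact: can_inj cr.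
exists v; rewrite vE //; apply/imsetP; exists (col t) => //.
by rewrite /r eqxx.
Qed.

Lemma cell_labelE (c : cw_cell X) : cell_label vertex_label c = mesym1 (val c).
Proof.
apply: big_mlcm => [v|t]; first by rewrite is_faceE mesym1_le.
rewrite mesym1_coord; case: (boolP (t \in val c)) => // tc _.
have [v tv vc] := vertex_through tc; exists v; first by rewrite is_faceE.
by rewrite mesym1_coord tv.
Qed.

Local Notation chains i := {ffun cells X i -> P^o}.

(** Extension by zero from cells to all sets of variables, so that chains of every degree have the
    same index type. *)
Definition ext i (v : chains i) A : P := \sum_(c : cells X i | vset c == A) v c.

(* The part of v in multidegree u, as a scalar chain on sets. *)
Definition strand i (v : chains i) u A : K :=
  if (mesym1 A <= u)%MM then (ext v A)@_(u - mesym1 A) else 0.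

Lemma ext_vset i (v : chains i) c : ext v (vset c) = v c.
Proof.
rewrite /ext (bigD1 c) //= big1 ?addr0 // => d /andP[/eqP/vset_inj -> ].
by rewrite eqxx.
Qed.

Lemma ext_neq0 i (v : chains i) A : ext v A != 0 -> exists c : cells X i, vset c = A.
Proof.
have [//|no] := pselect (exists c : cells X i, vset c = A).
by move/eqP; case; apply: big1 => c /eqP e; case: no; exists c.
Qed.

Lemma sum_ext i (v : chains i) (G : {set 'I_N} -> P) :
  \sum_c v c * G (vset c) = \sum_A ext v A * G A.
Proof.
under [RHS]eq_bigr do rewrite mulr_suml.
rewrite (exchange_big_dep xpredT) //=; apply: eq_bigr => c _.
by rewrite (big_pred1 (vset c)) // => A; rewrite /= eq_sym.
Qed.

(** Labels are squarefree, so whether one divides the monomial of [u] depends only on the support of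
    [u]. *)
Lemma strand_chain i (v : chains i) u :
  chain col Delta [set t | u t != 0%N] (i + n) (strand v u).
Proof.
move=> A; rewrite /strand; case: ifP => [|_]; last by rewrite eqxx.
rewrite mesym1_le_supp => Au h.
have [c e] : exists c : cells X i, vset c = A.
  by apply: (@ext_neq0 _ v); apply: contraNneq h => ->; rewrite mcoeff0.
by rewrite -e in Au *; rewrite good_vset card_vset.
Qed.

Lemma strand_inj i (v w : chains i) :
  (forall u A, strand v u A = strand w u A) -> v = w.
Proof.
move=> h; apply/ffunP => c; apply/mpolyP => m.
have := h (m + mesym1 (vset c))%MM (vset c).
by rewrite /strand lem_addl addmK !ext_vset.
Qed.

Local Notation eps := (incidence (col := col) ht (Delta_down := Delta_down)).
Local Notation D i := (@cell_diff R X K N vertex_label eps i).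

Lemma cell_diffE i c d : D i c d =
  inc col ht P (vset c) (vset d) * 'X_[mesym1 (vset c) - mesym1 (vset d)].
Proof.
rewrite /cell_diff sum_ffunE.
under eq_bigr do rewrite !ffunE /incidence intr_inc !cell_labelE.
rewrite big_mkcond (bigD1 d) //= eqxx big1 ?addr0 => [|t /negPf td]; last first.
  by case: ifP => // _; rewrite eq_sym td scaler0.
case: ifP => [_|/facetP nf]; first by rewrite /GRing.scale /= mulr1.
rewrite (_ : inc _ _ _ _ _ = 0) ?mul0r //.
by apply/eqP/negPn/negP => /inc_neq0; exact: nf.
Qed.

Lemma lin_ext_diffE i (v : chains i.+1) d : lin_ext (D i) v d =
  \sum_A ext v A * (inc col ht P A (vset d) * 'X_[mesym1 A - mesym1 (vset d)]).
Proof.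
rewrite -(sum_ext v (fun A => inc col ht P A (vset d) * 'X_[mesym1 A - mesym1 (vset d)])).
rewrite /lin_ext sum_ffunE; apply: eq_bigr => c _.
by rewrite ffunE cell_diffE.
Qed.

(** The monomial factors of the differential are absorbed by the degree shift from [mesym1 B] to
    [mesym1 A], and only the simplicial signs remain. Fullness of [A] matters: elsewhere there is no
    cell, but the simplicial boundary may be nonzero. *)
Lemma strand_diff i (v : chains i.+1) u A : full col A ->
  strand (lin_ext (D i) v) u A = bd col ht (strand v u) A.
Proof.
move=> fA; have [[d dA]|no] := pselect (exists d : cells X i, vset d = A); last first.
  transitivity (0 : K).
    apply/eqP/negPn/negP => /strand_chain[gA _ cA]; apply: no; exact: vset_ex.
  apply/esym/eqP/negPn/negP => /(bd_chain Delta_down (@strand_chain _ v u) fA)[gA _ [cA]].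
  by apply: no; exact: vset_ex.
case: (boolP (mesym1 A <= u)%MM) => Au; last first.
  rewrite {1}/strand (negPf Au); apply/esym/eqP/negPn/negP.
  move=> /(bd_chain Delta_down (@strand_chain _ v u) fA)[_ Au' _].
  by rewrite mesym1_le_supp Au' in Au.
rewrite {1}/strand Au -dA ext_vset lin_ext_diffE dA raddf_sum /= bd_inc.
apply: eq_bigr => B _.
have [B0|/inc_neq0[t tA BE]] := eqVneq (inc col ht int B A) 0.
  have z (L : comNzRingType) : inc col ht L B A = 0 by rewrite -intr_inc B0 mulr0z.
  by rewrite !z mul0r mulr0 mcoeff0 mulr0.
have AB : A \subset B by rewrite BE finset.subsetUr.
rewrite -[inc _ _ P _ _]intr_inc -[inc _ _ K _ _]intr_inc mulrCA mulrzl.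
rewrite raddfMz /= mcoeff_mulX [RHS]mulrzr.
apply: (congr1 (fun z : K => z *~ inc col ht int B A)); rewrite /strand.
have le1 : (mesym1 A <= mesym1 B)%MM by rewrite mesym1_le.
have -> : (mesym1 B - mesym1 A <= u - mesym1 A)%MM = (mesym1 B <= u)%MM.
  apply/mnm_lepP/mnm_lepP => h t'; have := h t'; have := mnm_lepP le1 t';
    have := mnm_lepP Au t'; rewrite !mnmBE; lia.
case: ifP => // Bu; apply: (congr1 (fun m => mcoeff m (ext v B))).
by rewrite submDA addmBA // addmC addmK.
Qed.

Definition aug (c : cells X 0) : P^o := 'X_[vertex_label c].

Lemma mcoeff_aug (v : chains 0) u : (lin_ext aug v)@_u = \sum_A strand v u A.
Proof.
rewrite /lin_ext (_ : \sum_c _ = \sum_A ext v A * 'X_[mesym1 A]).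
  by rewrite raddf_sum; apply: eq_bigr => A _; rewrite /= mcoeff_mulX.
exact: (sum_ext v (fun A => 'X_[mesym1 A])).
Qed.

Lemma strand0 i u A : strand (0 : chains i) u A = 0.
Proof.
rewrite /strand /ext big1 ?mcoeff0 ?if_same // => c _; by rewrite ffunE.
Qed.

Lemma diff_eq0P i (v : chains i.+1) : lin_ext (D i) v = 0 <->
  forall u A, full col A -> bd col ht (strand v u) A = 0.
Proof.
split=> [e u A fA|h]; first by rewrite -strand_diff // e strand0.
apply: strand_inj => u A; rewrite strand0; apply/eqP/negPn/negP => h'.
have [/andP[fA _] _ _] := strand_chain h'.
by rewrite strand_diff // h // eqxx in h'.
Qed.

(** If [W] misses a color, it contains no full set and the chain is zero. Otherwise the lowest
    elements of [W] in each color serve as apexes. *)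
Lemma strand_fill W k (f : {set 'I_N} -> K) :
  chain col Delta W k f -> is_cycle col ht k f ->
  exists2 g, chain col Delta W k.+1 g & forall B, full col B -> bd col ht g B = f B.
Proof.
move=> cf zf; case: (boolP (full col W)) => fW; last first.
  have f0 A : f A = 0.
    apply/eqP/negPn/negP => /cf[/andP[fA _] AW _].
    by case/negP: fW; apply: full_sub fA.
  exists (fun=> 0) => [A|B _]; first by rewrite eqxx.
  by rewrite f0 /bd big1 // => s _; rewrite mulr0.
have /choice[mn mnP] i : exists t, [/\ t \in W, col t = i &
    forall s, s \in W -> col s = i -> (ht t <= ht s)%N].
  have [t0 tW /eqP ti] := fullP _ _ fW i.
  have P0 : (t0 \in W) && (col t0 == i) by rewrite tW.
  case: (@arg_minnP _ t0 (fun t => (t \in W) && (col t == i)) ht P0) => t.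
  move=> /andP[tW' /eqP ti'] tmin; exists t; split=> // s sW si.
  by apply: tmin; rewrite sW si eqxx.
apply: (@strand_exact _ _ col ht col_ht_inj K Delta Delta_down Delta_min W mn) => //.
- by move=> i; have [] := mnP i.
- by move=> i; have [] := mnP i.
- by move=> s sW; have [_ _] := mnP (col s); apply.
Qed.

(** Fillings are chosen separately for each multidegree; this finite list outside which [v] has no
    strand lets them be summed to one element. *)
Definition degrees i (v : chains i) : seq 'X_{1..N} :=
  undup (flatten [seq [seq (m + mesym1 (vset c))%MM | m <- msupp (v c)]
                 | c <- enum (cells X i)]).

Lemma strand_notin i (v : chains i) u A : u \notin degrees v -> strand v u A = 0.
Proof.
move=> ud; apply/eqP/negPn/negP => h; case/negP: ud.
have [gA Au cA] := strand_chain h; have [c cE] := vset_ex gA cA.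
rewrite mem_undup; apply/flattenP.
exists [seq (m + mesym1 (vset c))%MM | m <- msupp (v c)].
  by apply/mapP; exists c; rewrite ?mem_enum.
rewrite -mesym1_le_supp -cE in Au; apply/mapP.
exists (u - mesym1 (vset c))%MM; last by rewrite submK.
by rewrite mcoeff_msupp; move: h; rewrite /strand -cE Au ext_vset.
Qed.

Definition assemble i (U : seq 'X_{1..N}) (g : 'X_{1..N} -> {set 'I_N} -> K) : chains i :=
  [ffun c => \sum_(u <- U) g u (vset c) *: 'X_[u - mesym1 (vset c)]].

Lemma strand_assemble i U g u A : uniq U ->
  (forall u, chain col Delta [set t | u t != 0%N] (i + n) (g u)) ->
  strand (assemble i U g) u A = if u \in U then g u A else 0.
Proof.
move=> uU gc; have [[c cE]|no] := pselect (exists c : cells X i, vset c = A); last first.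
  transitivity (0 : K).
    by apply/eqP/negPn/negP => /strand_chain[gA _ cA]; apply: no; exact: vset_ex.
  case: ifP => // _; apply/esym/eqP/negPn/negP => /gc[gA _ cA].
  by apply: no; exact: vset_ex.
rewrite /strand; case: ifP => Au; last first.
  case: ifP => // _; apply/esym/eqP/negPn/negP => /gc[_].
  by rewrite -mesym1_le_supp Au.
rewrite -cE ext_vset ffunE cE raddf_sum /=.
rewrite (eq_bigr (fun u' => if u' == u then g u A else 0)) => [|u' _].
  case: ifP => [uin|/negbT uout].
    by rewrite (bigD1_seq u) //= eqxx big1 ?addr0 // => u' /negPf ->.
  rewrite big1_seq // => u' /andP[_ uin]; case: eqP => // e.
  by rewrite -e uin in uout.
rewrite mcoeffZ mcoeffX; case: (u' =P u) => [->|u'u]; first by rewrite eqxx mulr1.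
(* Subtraction of multidegrees is truncated, hence cancellable only above [mesym1 A]; a nonzero
   [g u' A] ensures that [u'] is there. *)
have [g0|/gc[_]] := eqVneq (g u' A) 0; first by rewrite g0 mul0r.
rewrite -mesym1_le_supp => Au' _; case: eqP => [e|_]; last by rewrite mulr0.
by case: u'u; rewrite -(submK Au) -(submK Au') e.
Qed.

Lemma exact_at i (v : chains i) :
  (forall u, is_cycle col ht (i + n) (strand v u)) ->
  range (lin_ext (D i)) v.
Proof.
move=> zv.
have /choice[g gP] u : exists g, chain col Delta [set t | u t != 0%N] (i + n).+1 g /\
    forall B, full col B -> bd col ht g B = strand v u B.
  by have [g] := strand_fill (@strand_chain _ v u) (zv u); exists g.
exists (assemble i.+1 (degrees v) g) => //.
have gc u : chain col Delta [set t | u t != 0%N] (i.+1 + n) (g u) by have [] := gP u.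
apply: strand_inj => u A; case: (boolP (full col A)) => fA; last first.
  transitivity (0 : K); [|apply/esym]; apply/eqP/negPn/negP => /strand_chain;
  by case=> /andP[fA' _] _ _; rewrite fA' in fA.
rewrite strand_diff //.
transitivity (bd col ht (fun B => if u \in degrees v then g u B else 0) A).
  by apply: eq_bigr => s _; rewrite strand_assemble // undup_uniq.
case: (boolP (u \in degrees v)) => ud; first by have [_ h] := gP u; exact: h.
by rewrite strand_notin // /bd big1 // => s _; rewrite mulr0.
Qed.

End Chains.

(** * The cellular resolution *)

Section MonomialIdealMembership.
Local Open Scope classical_set_scope.
Variables (K : fieldType) (N : nat).
Implicit Types (M : set 'X_{1..N}) (a m : 'X_{1..N}).

(** If no generator divides the monomial, its coefficient in every combination of the generators is
    zero. *)
Lemma monomial_idealP M m :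
  ideal_gen [set ('X_[a] : {mpoly K[N]}) | a in M] 'X_[m] <->
  exists2 a, M a & (a <= m)%MM.
Proof.
split=> [[s sM e]|[a Ma am]]; last first.
  exists [:: ('X_[m - a], 'X_[a])] => [cg|].
    by rewrite inE => /eqP ->; exists a.
  by rewrite big_seq1 /= -mpolyXD submK.
have [//|no] := pselect (exists2 a, M a & (a <= m)%MM).
have := mcoeffX K m m; rewrite eqxx [in X in X -> _]e raddf_sum /=.
rewrite big1_seq => [/eqP|cg /andP[_ cgs]].
  by rewrite eq_sym oner_eq0.
have [a Ma <-] := sM _ cgs; rewrite mcoeff_mulX; case: ifP => // am.
by case: no; exists a.
Qed.

End MonomialIdealMembership.

Section Cellular.
Local Open Scope classical_set_scope.
Variables (N n : nat) (col : 'I_N -> 'I_n) (ht : 'I_N -> nat).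
Hypothesis col_ht_inj : forall s t, col s = col t -> ht s = ht t -> s = t.
Variables (R : realType) (Delta : {set 'I_N} -> bool).
Hypothesis Delta_down :
  forall A B : {set 'I_N}, A \subset B -> Delta B -> Delta A.
Hypothesis Delta_min : forall (A : {set 'I_N}) s t, Delta A -> s \in A ->
  col s = col t -> (ht t <= ht s)%N -> Delta (t |: A).
Variable K : fieldType.

Let X := cell_complex R col Delta_down.
Local Notation P := {mpoly K[N]}.
Local Notation lab := (@vertex_label N n col R Delta Delta_down).
Local Notation eps := (incidence (col := col) ht (Delta_down := Delta_down)).
Local Notation D i := (@cell_diff R X K N lab eps i).
Local Notation augm := (@aug N n col R Delta Delta_down K).
Local Notation J := (ideal_gen [set ('X_[a] : P) | a in range lab]).

Lemma range_aug : range (lin_ext augm) = J.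
Proof.
apply/seteqP; split=> [_ [v _ <-]|f [s sM ->]].
  exists [seq (v c, 'X_[lab c]) | c <- enum (cells X 0)] => [cg|].
    by move=> /mapP[c _ ->]; exists (lab c).
  by rewrite big_map big_enum.
elim: s sM => [|[c g] s IH] sM.
  exists 0 => //; rewrite big_nil /lin_ext big1 // => c _.
  by rewrite ffunE scale0r.
have [|w _ wE] := IH; first by move=> cg cgs; apply: sM; rewrite inE cgs orbT.
have [_ [v _ <-] /= vE] := sM (c, g) (mem_head _ _).
exists (w + c *: ebasis K N v) => //; rewrite big_cons /= -wE -vE addrC /lin_ext.
under eq_bigr do rewrite !ffunE scalerDl.
rewrite big_split /=; congr (_ + _); rewrite (bigD1 v) //= eqxx big1 ?addr0.
  by rewrite /GRing.scale /= mulr1.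
by move=> u /negPf ->; rewrite scaler0 scale0r.
Qed.

(** All vertices have exactly [n] elements, so one label divides another only if they are equal:
    every generator is minimal. *)
Lemma labels_bij : set_bij setT (min_mon_gens (J : set P)) lab.
Proof.
have anti v w : (lab v <= lab w)%MM -> v = w.
  rewrite mesym1_le => vw; apply/vset_inj/eqP.
  by rewrite eqEcard vw !card_vset leqnn.
split=> [v _|v w _ _ e|m [/monomial_idealP[_ [v _ <-] vm] mmin]].
- split=> [|m' m'v /monomial_idealP[_ [w _ <-] wm']].
    by apply/monomial_idealP; exists (lab v); rewrite ?lepm_refl.
  have e := anti _ _ (lepm_trans wm' m'v); subst w.
  apply/mnmP => t; apply/eqP; rewrite eqn_leq.
  by rewrite (mnm_lepP m'v) (mnm_lepP wm').
- by apply: anti; rewrite e lepm_refl.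
exists v => //; apply: mmin => //; apply/monomial_idealP.
by exists (lab v); rewrite ?lepm_refl.
Qed.

Lemma diff_diff i (w : {ffun cells X i.+2 -> P^o}) :
  lin_ext (D i) (lin_ext (D i.+1) w) = 0.
Proof.
apply/diff_eq0P => // u A fA.
rewrite -[RHS](bd_bd col_ht_inj (strand w u) A).
apply: eq_bigr => s _; congr (_ * _); apply: strand_diff.
exact: full_sub (finset.subsetUr _ _) fA.
Qed.

Lemma aug_diff (w : {ffun cells X 1 -> P^o}) :
  lin_ext augm (lin_ext (D 0) w) = 0.
Proof.
apply/mpolyP => u; rewrite mcoeff_aug mcoeff0.
rewrite -[RHS](sum_bd col_ht_inj (@strand_chain _ _ _ _ _ _ _ _ w u)) [RHS]big_mkcond.
apply: eq_bigr => A _; case: ifP => fA; first exact: strand_diff.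
by apply/eqP/negPn/negP => /strand_chain[/andP[]]; rewrite fA.
Qed.

Lemma cellular_resolution :
  minimal_resolution_supported_on_regular_cw R (J : set P).
Proof.
exists X, lab, eps; split; [exact: labels_bij|exact: incidenceP|split].
- split=> [c|i c d].
    by exists 1; rewrite scale1r; congr 'X_[_]; rewrite cell_labelE.
  rewrite /mhomog !cell_labelE cell_diffE -mulrA -mpolyXD.
  have [c0|/inc_neq0[t _ e]] := eqVneq (inc col ht int (vset c) (vset d)) 0.
    by exists 0; rewrite -intr_inc c0 mulr0z mul0r scale0r.
  exists (inc col ht K (vset c) (vset d)).
  have dc : vset d \subset vset c by rewrite e finset.subsetUr.
  rewrite submK; last by rewrite mesym1_le.
  by rewrite -[inc _ _ P _ _]intr_inc -[inc _ _ K _ _]intr_inc mulrzl scaler_int.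
- exact: range_aug.
- apply/seteqP; split=> [v /= v0|_ [w _ <-]]; last exact: aug_diff.
  apply: (exact_at col_ht_inj Delta_min) => u; split=> [B fB|_]; last first.
    by rewrite -(mcoeff_aug v u) v0 mcoeff0.
  (* The boundary of a vertex lives on sets with [n - 1] elements, and none of these is full. *)
  apply/eqP/negPn/negP.
  move=> /(bd_chain Delta_down (@strand_chain _ _ _ _ _ _ _ _ v u) fB)[_ _ cB].
  by have := full_card fB; rewrite -[leqLHS]cB ltnn.
- move=> i; apply/seteqP; split=> [v /= v0|_ [w _ <-]]; last exact: diff_diff.
  apply: (exact_at col_ht_inj Delta_min) => u; split=> [B fB|]; last by lia.
  by move/diff_eq0P: v0; apply.
(* A nonzero constant term would force the larger set [vset c] into [vset d]. *)
move=> i c d; rewrite cell_diffE mcoeff_mulX; case: ifP => // h.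
have : vset c \subset vset d.
  apply/fintype.subsetP => t tc; have := mnm_lepP h t.
  by rewrite mnmBE !mesym1_coord tc mnm0E; case: (t \in vset d).
by move=> /subset_leq_card; rewrite !card_vset addSn ltnn.
Qed.

End Cellular.

(** * The generators of L(I) *)

Section LIcells.
Local Open Scope classical_set_scope.
Variables (K : fieldType) (n : nat) (I : set {mpoly K[n]}) (b : 'I_n -> nat).
Hypothesis I_monomial : monomial_ideal I.

Lemma Mon_compl_down a a' : (a' <= a)%MM -> Mon_compl I a -> Mon_compl I a'.
Proof.
rewrite /Mon_compl; have [M ->] := I_monomial => a'a Ia.
move=> /monomial_idealP[m Mm ma']; apply/Ia/monomial_idealP.
by exists m => //; exact: lepm_trans ma' a'a.
Qed.

Local Notation N := #|wp_index b|.

Definition wp_col (t : 'I_N) : 'I_n := tag (enum_val t).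
Definition wp_ht (t : 'I_N) : nat := tagged (enum_val t).

Lemma wp_col_ht_inj s t : wp_col s = wp_col t -> wp_ht s = wp_ht t -> s = t.
Proof.
rewrite /wp_col /wp_ht => cst hst; apply: enum_val_inj; move: cst hst.
case: (enum_val s) (enum_val t) => [i j] [i' j'] /= ii; subst i' => jj.
by congr existT; apply: ord_inj.
Qed.

Definition wp_idx i (j : 'I_(b i)) : 'I_N :=
  enum_rank (existT (fun i => 'I_(b i)) i j : wp_index b).

Lemma wp_col_idx i (j : 'I_(b i)) : wp_col (wp_idx j) = i.
Proof. by rewrite /wp_col enum_rankK. Qed.

Lemma wp_ht_idx i (j : 'I_(b i)) : wp_ht (wp_idx j) = j.
Proof. by rewrite /wp_ht enum_rankK. Qed.

Lemma wp_idx_ex t i : wp_col t = i -> exists j : 'I_(b i), wp_idx j = t.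
Proof.
move=> <-; exists (tagged (enum_val t)); rewrite /wp_idx /wp_col.
by rewrite -[RHS]enum_valK; case: (enum_val t).
Qed.

(** Bounding by some exponent vector outside [I], instead of taking maxima, also makes sense for
    sets missing a color. On full sets the two agree by [Mon_compl_down]. *)
Definition dominated (A : {set 'I_N}) : bool :=
  `[< exists2 a, Mon_compl I a & forall t, t \in A -> (wp_ht t <= a (wp_col t))%N >].

Lemma dominated_down (A B : {set 'I_N}) :
  A \subset B -> dominated B -> dominated A.
Proof.
move=> /fintype.subsetP AB /asboolP[a Ia aB]; apply/asboolP; exists a => // t tA.
by apply: aB; apply: AB.
Qed.

Lemma dominated_min (A : {set 'I_N}) s t : dominated A -> s \in A ->
  wp_col s = wp_col t -> (wp_ht t <= wp_ht s)%N -> dominated (t |: A).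
Proof.
move=> /asboolP[a Ia aA] sA cst hst; apply/asboolP; exists a => // r.
rewrite !inE => /orP[/eqP ->|/aA //].
by rewrite -cst; apply: leq_trans hst (aA _ sA).
Qed.

(** A vertex picks one variable of each color. Its heights form an exponent vector below a
    dominating one, so they again give a monomial outside [I]. *)
Lemma LI_gensE (R : realType) : LI_gens b I =
  [set ('X_[a] : Swp K b) | a in range (@vertex_label _ _ wp_col R _ dominated_down)].
Proof.
have prodE (j : forall i, 'I_(b i)) : \prod_(i < n) wp_var K (j i) =
    'X_[mesym1 [set wp_idx (j i) | i : 'I_n]] :> Swp K b.
  rewrite /wp_var mprodXE; congr 'X_[_]; apply/mnmP => t.
  rewrite mnm_sumE mesym1_coord; under eq_bigr do rewrite mnm1E.
  case: imsetP => [[i _ ->]|no]; last first.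
    by rewrite big1 // => i _; case: eqP => // e; case: no; exists i.
  rewrite (bigD1 i) //= eqxx big1 // => i' /negPf i'i.
  case: eqP => // /(congr1 wp_col); rewrite -/(wp_idx _) !wp_col_idx => e.
  by rewrite e eqxx in i'i.
apply/seteqP; split=> [f [a Ia [j ja ->]]|_ [_ [v _ <-] <-]].
  have [||v vE] := @vset_ex _ _ wp_col R _ dominated_down 0 [set wp_idx (j i) | i : 'I_n].
  - apply/andP; split.
      apply/fullP => i; exists (wp_idx (j i)); last exact: wp_col_idx.
      by apply/imsetP; exists i.
    apply/asboolP; exists a => // t /imsetP[i _ ->].
    by rewrite wp_col_idx wp_ht_idx ja.
  - rewrite card_imset ?card_ord // => i i' /(congr1 wp_col).
    by rewrite !wp_col_idx.
  by exists (mesym1 (vset v)); [exists v|rewrite prodE vE].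
have /andP[fv dv] := good_vset v.
have jex i : exists j : 'I_(b i), wp_idx j \in vset v.
  have [t tv ti] := fullP _ _ fv i; have [j jE] := wp_idx_ex ti.
  by exists j; rewrite jE.
pose j i := sval (cid (jex i)).
have jv i : wp_idx (j i) \in vset v := svalP (cid (jex i)).
have vE : [set wp_idx (j i) | i : 'I_n] = vset v.
  apply/eqP; rewrite eqEcard card_vset card_imset ?card_ord ?leqnn ?andbT.
    by apply/fintype.subsetP => _ /imsetP[i _ ->].
  by move=> i i' /(congr1 wp_col); rewrite !wp_col_idx.
have /asboolP[a Ia av] := dv.
exists [multinom (j i : nat) | i < n]%MM.
  apply: Mon_compl_down Ia; apply/mnm_lepP => i; rewrite mnmE.
  by have := av _ (jv i); rewrite wp_col_idx wp_ht_idx.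
exists j => [i|]; first by rewrite mnmE.
by rewrite prodE vE.
Qed.

End LIcells.

Theorem corollary2p4 (R : realType) (K : fieldType) (n : nat)
    (I : set {mpoly K[n]}) (b : 'I_n -> nat)
    (I_monomial : monomial_ideal I)
    (I_dim0 : krull_dim_quot I 0)
    (b_min : forall i : 'I_n, is_min_pure_power I i (b i)) :
  minimal_resolution_supported_on_regular_cw R (LI b I).
Proof.
rewrite /LI (LI_gensE b I_monomial R).
exact: (cellular_resolution (@wp_col_ht_inj n b) R
  (@dominated_down K n I b) (@dominated_min K n I b) K).
Qed.
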